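(* Let $(B,\psi)$ be a finite quantum space with $\delta$-form $\psi$, and let $A$ be a rank one quantum adjacency matrix on $B$, given by $A(x)=TxT^*$. Write $T=\bigoplus_aT^{(a)}$ with respect to $B\cong\bigoplus_{a=1}^dM_{N_a}(\mathbb{C})$ and assume that each $T^{(a)}\neq0$. Then the Cuntz--Pimsner algebra of the quantum edge correspondence of $(B,\psi,A)$ is isomorphic to $B\otimes C(\mathbb{T})$.
   Context: A finite quantum space $(B,\psi)$ is a finite-dimensional C*-algebra $B\cong\bigoplus_{a=1}^dM_{N_a}(\mathbb{C})$ with a faithful state $\psi$ that is a $\delta$-form, $\delta>0$: if $m\colon B\otimes B\to B$ is multiplication and $m^*\colon B\to B\otimes B$ is its adjoint with respect to the inner products $\langle x,y\rangle_\psi=\psi(x^*y)$ on $B$ and $\langle\cdot,\cdot\rangle_{\psi\otimes\psi}$ on $B\otimes B$, then $mm^*=\delta^2\,\mathrm{id}_B$. Let $\rho_a$ be the density matrix of $\psi$ restricted to $M_{N_a}(\mathbb{C})$ with respect to the usual (unnormalized) trace $\mathrm{Tr}$, i.e. $\psi(x)=\mathrm{Tr}(\rho_ax)$ for $x\in M_{N_a}(\mathbb{C})$; the $\delta$-form condition is equivalent to $\mathrm{Tr}(\rho_a^{-1})=\delta^2$ for all $a$. A quantum graph $\mathcal{G}=(B,\psi,A)$ is a finite quantum space with a linear map $A\colon B\to B$ satisfying $m(A\otimes A)m^*=\delta^2A$ (a quantum adjacency matrix). If $T\in B$ satisfies $\mathrm{Tr}(\rho_a^{-1}T^*T)=\delta^2$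 for all $1\le a\le d$ (the trace being over the $a$-th summand), then $A(x):=TxT^*$ is called a quantum adjacency matrix of rank one (such $A$ is a quantum adjacency matrix). $\mathbb{T}$ is the unit circle. A C*-correspondence over $B$ is a right Hilbert $B$-module $X$ with a $*$-homomorphism $\varphi_X\colon B\to\mathcal{L}(X)$ into the adjointable operators; write $x\cdot\xi=\varphi_X(x)\xi$. $B\otimes_\psi B$ is the C*-correspondence over $B$ with underlying space $B\otimes B$, actions $x\cdot(a\otimes b)\cdot y=(xa)\otimes(by)$ and inner product $\langle a\otimes b,c\otimes d\rangle_B=b^*\psi(a^*c)d$. The quantum edge correspondence of $\mathcal{G}$ is the subcorrespondence $E_{\mathcal{G}}=\mathrm{span}\{x\cdot\epsilon_{\mathcal{G}}\cdot y: x,y\in B\}$ of $B\otimes_\psi B$, where $\epsilon_{\mathcal{G}}=\frac{1}{\delta^2}(\mathrm{id}\otimes A)m^*(1_B)$. A representation of a C*-correspondence $X$ over $B$ on a C*-algebra $D$ is a pair $(\pi,t)$ with $\pi\colon B\to D$ a $*$-homomorphism and $t\colon X\to D$ linear such that $\pi(x)t(\xi)=t(x\cdot\xi)$ and $t(\xi)^*t(\eta)=\pi(\langle\xi,\eta\rangle_B)$. With $\theta_{\xi,\eta}(\zeta)=\xi\cdot\langle\eta,\zeta\rangle_B$ generating the compact operators $\mathcal{K}(X)$, let $\psi_t\colon\mathcal{K}(X)\to D$ be the $*$-homomorphism with $\psi_t(\theta_{\xi,\eta})=t(\xi)t(\eta)^*$. The representation is covariant if $\pi(x)=\psi_t(\varphi_X(x))$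 for all $x\in J_X=\{x\in B:\varphi_X(x)\in\mathcal{K}(X),\ xy=0\ \forall y\in\ker\varphi_X\}$. The Cuntz--Pimsner algebra is $\mathcal{O}_X=C^*(\pi_X(B),t_X(X))$ where $(\pi_X,t_X)$ is the universal covariant representation. *)

(* Defs.v *)
From HB Require Import structures.
From mathcomp Require Import all_boot all_order all_algebra.
From mathcomp Require Import all_classical all_reals all_analysis.
From mathcomp Require Import complex ring.

Set Implicit Arguments.
Unset Strict Implicit.
Unset Printing Implicit Defensive.

Import Order.TTheory GRing.Theory Num.Theory numFieldNormedType.Exports.

Local Open Scope classical_set_scope.
Local Open Scope ring_scope.

(* The field [C] below is any algebraically closed numeric field; it is       *)
(* specialized to the complex numbers [R[i]], [R : realType], in the theorem. *)

(* Algebras need not be unital.                                               *)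
HB.mixin Record Lmodule_isStarAlgebra (C : numClosedFieldType) A
    of GRing.Lmodule C A := {
  amul : A -> A -> A ;
  astar : A -> A ;
  amulA : associative amul ;
  amulDl : left_distributive amul +%R ;
  amulDr : right_distributive amul +%R ;
  amulZl : forall (k : C) x y, amul (k *: x) y = k *: amul x y ;
  amulZr : forall (k : C) x y, amul x (k *: y) = k *: amul x y ;
  astarK : involutive astar ;
  astarD : {morph astar : x y / x + y} ;
  astarZ : forall (k : C) x, astar (k *: x) = k^* *: astar x ;
  astarM : forall x y, astar (amul x y) = amul (astar y) (astar x)
}.

#[short(type="starAlgType")]
HB.structure Definition StarAlgebra (C : numClosedFieldType) :=
  {A of Lmodule_isStarAlgebra C A & GRing.Lmodule C A}.

HB.mixin Record StarAlgebra_isCstar (C : numClosedFieldType) A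
    of StarAlgebra C A & CompleteNormedModule C A := {
  norm_amul : forall x y : A, `|amul x y| <= `|x| * `|y| ;
  norm_cstar : forall x : A, `|amul (astar x) x| = `|x| ^+ 2
}.

#[short(type="cstarAlgType")]
HB.structure Definition CstarAlgebra (C : numClosedFieldType) :=
  {A of StarAlgebra C A & CompleteNormedModule C A & StarAlgebra_isCstar C A}.

Notation "x ** y" := (amul x y) (at level 40, left associativity) : ring_scope.

Definition star_hom (C : numClosedFieldType) (A D : starAlgType C)
    (f : A -> D) : Prop :=
  [/\ linear f, forall x y, f (x ** y) = f x ** f y
    & forall x, f (astar x) = astar (f x)].

(* Between C*-algebras such a map is automatically isometric.                 *)
Definition star_isomorphic (C : numClosedFieldType) (A D : starAlgType C) :
  Prop := exists2 f : A -> D, star_hom f & bijective f.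

Section StarAlgebraTheory.
Context (C : numClosedFieldType) (A : starAlgType C).
Implicit Types x y : A.

Lemma amul0l x : 0 ** x = 0.
Proof. by rewrite -[X in X ** _](scale0r (0 : A)) amulZl scale0r. Qed.

Lemma amul0r x : x ** 0 = 0.
Proof. by rewrite -[X in _ ** X](scale0r (0 : A)) amulZr scale0r. Qed.

Lemma astar0 : astar (0 : A) = 0.
Proof. by rewrite -[X in astar X](scale0r (0 : A)) astarZ conjC0 scale0r. Qed.

Lemma amul_suml (I : Type) (r : seq I) (P : pred I) (F : I -> A) x :
  (\sum_(i <- r | P i) F i) ** x = \sum_(i <- r | P i) (F i ** x).
Proof.
by apply: (big_morph (fun y => y ** x)) => [y z|]; rewrite ?amulDl ?amul0l.
Qed.

Lemma amul_sumr (I : Type) (r : seq I) (P : pred I) (F : I -> A) x :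
  x ** (\sum_(i <- r | P i) F i) = \sum_(i <- r | P i) (x ** F i).
Proof. by apply: big_morph => [y z|]; rewrite ?amulDr ?amul0r. Qed.

Lemma astar_sum (I : Type) (r : seq I) (P : pred I) (F : I -> A) :
  astar (\sum_(i <- r | P i) F i) = \sum_(i <- r | P i) astar (F i).
Proof. by apply: big_morph => [y z|]; rewrite ?astarD ?astar0. Qed.

End StarAlgebraTheory.

Section Scalars.
Context (C : numClosedFieldType).

Local Definition smul (x y : C^o) : C^o := (x : C) * y.
Local Definition sstar (x : C^o) : C^o := (x : C)^*.

Local Fact smulA : associative smul. Proof. exact: mulrA. Qed.
Local Fact smulDl : left_distributive smul +%R. Proof. exact: mulrDl. Qed.
Local Fact smulDr : right_distributive smul +%R. Proof. exact: mulrDr. Qed.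
Local Fact smulZl (k : C) (x y : C^o) : smul (k *: x) y = k *: smul x y.
Proof. by rewrite /smul /GRing.scale /= mulrA. Qed.
Local Fact smulZr (k : C) (x y : C^o) : smul x (k *: y) = k *: smul x y.
Proof. by rewrite /smul /GRing.scale /= mulrCA. Qed.
Local Fact sstarK : involutive sstar. Proof. exact: conjCK. Qed.
Local Fact sstarD : {morph sstar : x y / x + y}.
Proof. by move=> x y; rewrite /sstar rmorphD. Qed.
Local Fact sstarZ (k : C) (x : C^o) : sstar (k *: x) = k^* *: sstar x.
Proof. by rewrite /sstar /GRing.scale /= rmorphM. Qed.
Local Fact sstarM (x y : C^o) : sstar (smul x y) = smul (sstar y) (sstar x).
Proof. by rewrite /smul /sstar rmorphM mulrC. Qed.

HB.instance Definition _ := Lmodule_isStarAlgebra.Build C C^o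
  smulA smulDl smulDr smulZl smulZr sstarK sstarD sstarZ sstarM.

End Scalars.

Section Circle.
Context (C : numClosedFieldType).

Definition circle : set C^o := [set z | `|z| = 1].

Definition Ccircle := continuousType circle C^o.
HB.instance Definition _ := Choice.on Ccircle.

Local Fact circle_filter (z : circle) : Filter (nbhs z).
Proof. exact: nbhs_filter. Qed.
Local Fact Ccircle_cvg (f : Ccircle) z : f w @[w --> z] --> f z.
Proof. exact: cts_fun. Qed.

Local Fact addf_cts (f g : Ccircle) : continuous (fun z => f z + g z).
Proof. by move=> z;
  exact: (@cvgD C C^o _ _ (circle_filter z) f g _ _ (@Ccircle_cvg f z) (@Ccircle_cvg g z)). Qed.
Local Fact oppf_cts (f : Ccircle) : continuous (fun z => - f z).
Proof. by move=> z;
  exact: (@cvgN C C^o _ _ (circle_filter z) f _ (@Ccircle_cvg f z)). Qed.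
Local Fact mulf_cts (f g : Ccircle) : continuous (fun z => f z ** g z : C^o).
Proof. by move=> z;
  exact: (@cvgM C _ _ (circle_filter z) f g _ _ (@Ccircle_cvg f z) (@Ccircle_cvg g z)). Qed.
Local Fact starf_cts (f : Ccircle) : continuous (fun z => astar (f z) : C^o).
Proof.
move=> z; apply/(@cvgrPdist_lt C C^o _ _ (circle_filter z)) => e e0.
move: (@Ccircle_cvg f z) => /(@cvgrPdist_lt C C^o _ _ (circle_filter z))
  /(_ e e0).
apply: filterS => w.
have -> : astar (f z) - astar (f w) = (((f z : C) - f w)^* : C^o).
  by rewrite rmorphB.
by rewrite norm_conjC.
Qed.
Local Fact scalef_cts (k : C) (f : Ccircle) : continuous (fun z => k *: f z).
Proof. by move=> z;
  exact: (@cvgZl_tmp C C^o _ _ (circle_filter z) k f _ (@Ccircle_cvg f z)). Qed.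

Local Definition cadd (f g : Ccircle) : Ccircle := mkcts (@addf_cts f g).
Local Definition copp (f : Ccircle) : Ccircle := mkcts (@oppf_cts f).
Local Definition czero : Ccircle := cst (0 : C^o).
Local Definition cmul (f g : Ccircle) : Ccircle := mkcts (@mulf_cts f g).
Local Definition cstar (f : Ccircle) : Ccircle := mkcts (@starf_cts f).
Local Definition cscale (k : C) (f : Ccircle) : Ccircle :=
  mkcts (@scalef_cts k f).

Local Ltac ext := repeat intro; apply/continuousEP => ?.

Local Fact caddA : associative cadd. Proof. by ext; exact: addrA. Qed.
Local Fact caddC : commutative cadd. Proof. by ext; exact: addrC. Qed.
Local Fact cadd0 : left_id czero cadd. Proof. by ext; exact: add0r. Qed.
Local Fact caddN : left_inverse czero copp cadd.
Proof. by ext; exact: addNr. Qed.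

HB.instance Definition _ :=
  GRing.isZmodule.Build Ccircle caddA caddC cadd0 caddN.

Local Fact cscaleA a b f : cscale a (cscale b f) = cscale (a * b) f.
Proof. by ext; exact: scalerA. Qed.
Local Fact cscale1 : left_id 1 cscale. Proof. by ext; exact: scale1r. Qed.
Local Fact cscaleDr : right_distributive cscale +%R.
Proof. by ext; exact: scalerDr. Qed.
Local Fact cscaleDl f : {morph cscale^~ f : a b / a + b}.
Proof. by ext; exact: scalerDl. Qed.

HB.instance Definition _ := GRing.Zmodule_isLmodule.Build C Ccircle
  cscaleA cscale1 cscaleDr cscaleDl.

Local Fact cmulA : associative cmul. Proof. by ext; exact: amulA. Qed.
Local Fact cmulDl : left_distributive cmul +%R.
Proof. by ext; exact: amulDl. Qed.
Local Fact cmulDr : right_distributive cmul +%R.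
Proof. by ext; exact: amulDr. Qed.
Local Fact cmulZl k f g : cmul (k *: f) g = k *: cmul f g.
Proof. by ext; exact: amulZl. Qed.
Local Fact cmulZr k f g : cmul f (k *: g) = k *: cmul f g.
Proof. by ext; exact: amulZr. Qed.
Local Fact cstarK : involutive cstar. Proof. by ext; exact: astarK. Qed.
Local Fact cstarD : {morph cstar : x y / x + y}.
Proof. by ext; exact: astarD. Qed.
Local Fact cstarZ k f : cstar (k *: f) = k^* *: cstar f.
Proof. by ext; exact: astarZ. Qed.
Local Fact cstarM f g : cstar (cmul f g) = cmul (cstar g) (cstar f).
Proof. by ext; exact: astarM. Qed.

HB.instance Definition _ := Lmodule_isStarAlgebra.Build C Ccircle
  cmulA cmulDl cmulDr cmulZl cmulZr cstarK cstarD cstarZ cstarM.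

End Circle.

(* [tens N V] is the tensor product of B = \bigoplus_a M_(N a)(C) with V: the *)
(* family z stands for \sum_i e_i (x) z i, where the e_i are the matrix units *)
(* of B, i = [mi p q] being the position (p, q) in the block a. Thus B        *)
(* itself is [tens N C^o]; and if D is a *-algebra, B (x) D is the direct sum *)
(* of the matrix algebras M_(N a)(D). As B is finite dimensional, B (x) D is  *)
(* also the C*-algebraic tensor product when D is a C*-algebra.               *)
Definition munits (d : nat) (N : 'I_d -> nat) : finType :=
  {a : 'I_d & ('I_(N a) * 'I_(N a))%type}.

Definition mi (d : nat) (N : 'I_d -> nat) (a : 'I_d) (p q : 'I_(N a)) :
  munits N := existT (fun a => ('I_(N a) * 'I_(N a))%type) a (p, q).

Definition tens (d : nat) (N : 'I_d -> nat) (V : Type) : Type :=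
  {ffun munits N -> V}.

Notation fdalg N C := (tens N C^o).

Section TensorInstances.
Context (C : numClosedFieldType) (d : nat) (N : 'I_d -> nat).

HB.instance Definition _ (V : lmodType C) :=
  GRing.Lmodule.copy (tens N V) {ffun munits N -> V}.
HB.instance Definition _ (V : vectType C) :=
  Vector.copy (tens N V) {ffun munits N -> V}.

Context (D : starAlgType C).
Implicit Types x y z : tens N D.

Definition tens_mul x y : tens N D := [ffun i : munits N =>
  let: existT a (p, q) := i in \sum_r x (mi p r) ** y (mi r q)].
Definition tens_star x : tens N D := [ffun i : munits N =>
  let: existT a (p, q) := i in astar (x (mi q p))].

Lemma tens_mulE x y a (p q : 'I_(N a)) :
  tens_mul x y (mi p q) = \sum_r x (mi p r) ** y (mi r q).
Proof. by rewrite ffunE. Qed.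
Lemma tens_starE x a (p q : 'I_(N a)) :
  tens_star x (mi p q) = astar (x (mi q p)).
Proof. by rewrite ffunE. Qed.

Lemma tensP x y :
  (forall a (p q : 'I_(N a)), x (mi p q) = y (mi p q)) -> x = y.
Proof. by move=> xy; apply/ffunP => -[a [p q]]; exact: xy. Qed.

Local Fact tens_mulA : associative tens_mul.
Proof.
move=> x y z; apply: tensP => a p q; rewrite !tens_mulE.
under eq_bigr do rewrite tens_mulE amul_sumr.
under [RHS]eq_bigr do rewrite tens_mulE amul_suml.
rewrite exchange_big; apply: eq_bigr => r _; apply: eq_bigr => s _.
exact: amulA.
Qed.
Local Fact tens_mulDl : left_distributive tens_mul +%R.
Proof.
move=> x y z; apply: tensP => a p q; rewrite [RHS]ffunE !tens_mulE -big_split.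
by apply: eq_bigr => r _; rewrite ffunE amulDl.
Qed.
Local Fact tens_mulDr : right_distributive tens_mul +%R.
Proof.
move=> x y z; apply: tensP => a p q; rewrite [RHS]ffunE !tens_mulE -big_split.
by apply: eq_bigr => r _; rewrite ffunE amulDr.
Qed.
Local Fact tens_mulZl (k : C) x y : tens_mul (k *: x) y = k *: tens_mul x y.
Proof.
apply: tensP => a p q; rewrite [RHS]ffunE !tens_mulE scaler_sumr.
by apply: eq_bigr => r _; rewrite ffunE amulZl.
Qed.
Local Fact tens_mulZr (k : C) x y : tens_mul x (k *: y) = k *: tens_mul x y.
Proof.
apply: tensP => a p q; rewrite [RHS]ffunE !tens_mulE scaler_sumr.
by apply: eq_bigr => r _; rewrite ffunE amulZr.
Qed.
Local Fact tens_starK : involutive tens_star.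
Proof. by move=> x; apply: tensP => a p q; rewrite !tens_starE astarK. Qed.
Local Fact tens_starD : {morph tens_star : x y / x + y}.
Proof.
by move=> x y; apply: tensP => a p q;
  rewrite [RHS]ffunE !tens_starE ffunE astarD.
Qed.
Local Fact tens_starZ (k : C) x : tens_star (k *: x) = k^* *: tens_star x.
Proof.
by apply: tensP => a p q; rewrite [RHS]ffunE !tens_starE ffunE astarZ.
Qed.
Local Fact tens_starM x y :
  tens_star (tens_mul x y) = tens_mul (tens_star y) (tens_star x).
Proof.
apply: tensP => a p q; rewrite tens_starE !tens_mulE astar_sum.
by apply: eq_bigr => r _; rewrite !tens_starE astarM.
Qed.

HB.instance Definition _ := Lmodule_isStarAlgebra.Build C (tens N D)
  tens_mulA tens_mulDl tens_mulDr tens_mulZl tens_mulZr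
  tens_starK tens_starD tens_starZ tens_starM.

End TensorInstances.

Section Linear.
Context (C : numClosedFieldType) (V W : lmodType C) (f : V -> W).
Context (f_lin : linear f).

Lemma linD x y : f (x + y) = f x + f y.
Proof. by have := f_lin 1 x y; rewrite !scale1r. Qed.

Lemma lin0 : f 0 = 0.
Proof. by have := f_lin (-1) 0 0; rewrite scaler0 addr0 scaleN1r addNr. Qed.

Lemma linZ k x : f (k *: x) = k *: f x.
Proof. by have := f_lin k x 0; rewrite lin0 !addr0. Qed.

Lemma lin_sum (I : Type) (r : seq I) (P : pred I) (F : I -> V) :
  f (\sum_(i <- r | P i) F i) = \sum_(i <- r | P i) f (F i).
Proof. exact: (big_morph f linD lin0). Qed.

End Linear.

Section TensorTheory.
Context (C : numClosedFieldType) (d : nat) (N : 'I_d -> nat).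
Notation B := (fdalg N C).

Definition munit (i : munits N) : B := [ffun j => (j == i)%:R].

Definition unitB : B := [ffun i => ((tagged i).1 == (tagged i).2)%:R].

Definition block a (x : B) : 'M[C]_(N a) := \matrix_(p, q) x (mi p q).

Definition etens (V : lmodType C) (x : B) (v : V) : tens N V :=
  [ffun i => x i *: v].

(* The linear map on B (x) V induced by the bilinear map f.                   *)
Definition tlift (V W : lmodType C) (f : B -> V -> W) (z : tens N V) : W :=
  \sum_i f (munit i) (z i).

Definition tmap (V W : lmodType C) (f : B -> B) (g : V -> W) :
  tens N V -> tens N W := tlift (fun x v => etens (f x) (g v)).

Definition mulB : tens N B -> B := tlift (fun x y => x ** y).

(* The sesquilinear map on B (x) V with                                       *)
(* (x (x) v, y (x) w) |-> psi (x^* y) f v w.                                  *)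
Definition tsesqui (V W : lmodType C) (psi : B -> C) (f : V -> V -> W)
    (z w : tens N V) : W :=
  \sum_i \sum_j psi (astar (munit i) ** munit j) *: f (z i) (w j).

Lemma munitE (i j : munits N) : munit i j = (j == i)%:R.
Proof. exact: ffunE. Qed.

Lemma sum_delta (I : finType) (V : lmodType C) (F : I -> V) i :
  \sum_j (i == j)%:R *: F j = F i.
Proof.
rewrite (bigD1 i) //= eqxx scale1r big1 ?addr0 // => j ji.
by rewrite eq_sym (negPf ji) scale0r.
Qed.

Lemma sum_munit (V : lmodType C) (z : tens N V) (i : munits N) :
  \sum_j (munit j i : C) *: z j = z i.
Proof.
by rewrite -[RHS](sum_delta z); apply: eq_bigr => j _; rewrite munitE.
Qed.

Lemma tens_sum (V : lmodType C) (z : tens N V) :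
  z = \sum_i etens (munit i) (z i).
Proof.
apply/ffunP => j; rewrite sum_ffunE -[LHS]sum_munit.
by apply: eq_bigr => i _; rewrite [RHS]ffunE.
Qed.

Lemma munit_sum (x : B) : x = \sum_i (x i : C) *: munit i.
Proof.
apply/ffunP => j; rewrite sum_ffunE -[LHS](sum_munit (V := C^o)).
by apply: eq_bigr => i _; rewrite [RHS]ffunE munitE; exact: mulrC.
Qed.

Section Bilinear.
Context (V W : lmodType C) (f : B -> V -> W).
Context (f_linl : forall v, linear (f^~ v)).
Context (f_linr : forall x, linear (f x)).

Lemma tlift_linear : linear (tlift f).
Proof.
move=> k z w; rewrite /tlift scaler_sumr -big_split; apply: eq_bigr => i _.
by rewrite !ffunE; exact: f_linr.
Qed.

Lemma tlift_etens x v : tlift f (etens x v) = f x v.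
Proof.
rewrite [in RHS](munit_sum x) (lin_sum (f_linl v)); apply: eq_bigr => i _.
by rewrite ffunE (linZ (f_linr _)) (linZ (f_linl _)).
Qed.

End Bilinear.

End TensorTheory.

Arguments unitB {C d N}.

Record fqspace (C : numClosedFieldType) (d : nat) (N : 'I_d -> nat) := FQSpace {
  fq_psi :> {linear fdalg N C -> C^o} ;
  fq_psi_ge0 : forall x : fdalg N C, 0 <= (fq_psi (astar x ** x) : C) ;
  fq_psi_faithful : forall x : fdalg N C, fq_psi (astar x ** x) = 0 -> x = 0 ;
  fq_psi1 : fq_psi unitB = 1 ;
  fq_delta : C ;
  fq_delta_gt0 : 0 < fq_delta ;
  (* m^*, which fq_mstarP determines since psi is faithful *)
  fq_mstar : fdalg N C -> tens N (fdalg N C) ;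
  fq_mstarP : forall (z : tens N (fdalg N C)) (x : fdalg N C),
    fq_psi (astar (mulB z) ** x) =
    tsesqui fq_psi (fun v w => fq_psi (astar v ** w)) z (fq_mstar x) ;
  fq_delta_form : forall x : fdalg N C,
    mulB (fq_mstar x) = fq_delta ^+ 2 *: x
}.

Section QuantumGraph.
Context (C : numClosedFieldType) (d : nat) (N : 'I_d -> nat).
Notation B := (fdalg N C).

Record qgraph := QGraph {
  qg_space :> fqspace C N ;
  qg_adj : {linear B -> B} ;
  qg_adjP : forall x : B,
    mulB (tmap qg_adj qg_adj (fq_mstar qg_space x)) =
    fq_delta qg_space ^+ 2 *: qg_adj x
}.

Definition density (psi : B -> C) a : 'M[C]_(N a) :=
  \matrix_(p, q) psi (munit C (mi q p)).

Lemma densityP (psi : {linear B -> C^o}) x :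
  psi x = \sum_a \tr (density psi a *m block a x).
Proof.
rewrite {1}(munit_sum x) linear_sum /= (eq_bigr (fun i : munits N =>
  psi (munit C (mi (tagged i).1 (tagged i).2)) *
  x (mi (tagged i).1 (tagged i).2))); last first.
  by move=> [a [p q]] _ /=; rewrite linearZ; exact: mulrC.
rewrite (eq_bigr (fun a => \sum_(u : 'I_(N a) * 'I_(N a))
  psi (munit C (mi u.1 u.2)) * x (mi u.1 u.2))); last first.
  move=> a _; rewrite /mxtrace -(pair_bigA _ (fun p q =>
    psi (munit C (mi p q)) * x (mi p q))) /= exchange_big /=.
  by apply: eq_bigr => p _; rewrite !mxE; apply: eq_bigr => q _; rewrite !mxE.
by rewrite sig_big_dep /=.
Qed.

Definition rank_one (G : qgraph) (T : B) : Prop :=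
  (forall a, \tr (invmx (density G a) *m block a (astar T ** T))
             = fq_delta G ^+ 2) /\
  (forall x, qg_adj G x = T ** x ** astar T).

Definition qg_eps (G : qgraph) : tens N B :=
  (fq_delta G ^+ 2)^-1 *: tmap id (qg_adj G) (fq_mstar G unitB).

Definition posB (x : B) : Prop :=
  forall a (v : 'I_(N a) -> C),
    0 <= \sum_p \sum_q (v p)^* * (x (mi p q) : C) * v q.

(* C*-correspondences over B, of finite dimension: such a module is complete, *)
(* and its adjointable operators are the linear maps that have an adjoint.    *)
Record corr := Corr {
  corr_sort :> vectType C ;
  cinner : corr_sort -> corr_sort -> B ;
  lact : B -> corr_sort -> corr_sort ;
  ract : corr_sort -> B -> corr_sort ;
  cinner_linear : forall xi, linear (cinner xi) ;
  cinner_sym : forall xi eta, astar (cinner xi eta) = cinner eta xi ;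
  cinner_ge0 : forall xi, posB (cinner xi xi) ;
  cinner_def : forall xi, cinner xi xi = 0 -> xi = 0 ;
  ract_linearl : forall y, linear (ract^~ y) ;
  ract_linearr : forall xi, linear (ract xi) ;
  ractM : forall xi x y, ract xi (x ** y) = ract (ract xi x) y ;
  ract1 : forall xi, ract xi unitB = xi ;
  cinner_ract : forall xi eta y, cinner xi (ract eta y) = cinner xi eta ** y ;
  lact_linearl : forall xi, linear (lact^~ xi) ;
  lact_linearr : forall x, linear (lact x) ;
  lactM : forall x y xi, lact (x ** y) xi = lact x (lact y xi) ;
  lact_ract : forall x xi y, lact x (ract xi y) = ract (lact x xi) y ;
  lact_star : forall x xi eta,
    cinner (lact x xi) eta = cinner xi (lact (astar x) eta)
}.

Section SubCorr.
Context (X : corr) (E : {vspace X}).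
Context (El : forall x xi, xi \in E -> lact x xi \in E).
Context (Er : forall xi y, xi \in E -> ract xi y \in E).

Local Definition sub_lact (x : B) (xi : subvs_of E) : subvs_of E :=
  Subvs (El x (subvsP xi)).
Local Definition sub_ract (xi : subvs_of E) (y : B) : subvs_of E :=
  Subvs (Er y (subvsP xi)).

Program Definition subcorr : corr :=
  @Corr (subvs_of E) (fun xi eta => cinner (vsval xi) (vsval eta))
    sub_lact sub_ract _ _ _ _ _ _ _ _ _ _ _ _ _ _.
Next Obligation.
by move=> xi k x y; rewrite (linearP vsval); exact: cinner_linear. Qed.
Next Obligation. by move=> xi eta; exact: cinner_sym. Qed.
Next Obligation. by move=> xi; exact: cinner_ge0. Qed.
Next Obligation.
by move=> xi /cinner_def xi0; apply: val_inj; rewrite /= xi0. Qed.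
Next Obligation.
by move=> y k u v; apply: val_inj => /=; exact: ract_linearl. Qed.
Next Obligation.
by move=> xi k u v; apply: val_inj => /=; exact: ract_linearr. Qed.
Next Obligation. by move=> xi x y; apply: val_inj; exact: ractM. Qed.
Next Obligation. by move=> xi; apply: val_inj; exact: ract1. Qed.
Next Obligation. by move=> xi eta y; exact: cinner_ract. Qed.
Next Obligation.
by move=> xi k u v; apply: val_inj => /=; exact: lact_linearl. Qed.
Next Obligation.
by move=> x k u v; apply: val_inj => /=; exact: lact_linearr. Qed.
Next Obligation. by move=> x y xi; apply: val_inj; exact: lactM. Qed.
Next Obligation. by move=> x xi y; apply: val_inj; exact: lact_ract. Qed.
Next Obligation. by move=> x xi eta; exact: lact_star. Qed.

End SubCorr.

Section Internal.
Context (Q : fqspace C N).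

Definition tens_inner (z w : tens N B) : B :=
  tsesqui Q (fun x y => astar x ** y) z w.
Definition tens_lact (x : B) : tens N B -> tens N B :=
  tmap (fun y => x ** y) id.
Definition tens_ract (z : tens N B) (y : B) : tens N B :=
  tmap id (fun x => x ** y) z.

Local Notation e i := (munit C i).

Local Fact mulB_linear (x : B) : linear (fun y : B => x ** y).
Proof. by move=> k u v; rewrite amulDr amulZr. Qed.

Local Fact mulBr_linear (y : B) : linear (fun x : B => x ** y).
Proof. by move=> k u v; rewrite amulDl amulZl. Qed.

Local Fact etens_linearl (V : lmodType C) (v : V) :
  linear (fun x : B => etens x v).
Proof.
move=> k x y; apply/ffunP => i; rewrite [RHS]ffunE !ffunE scalerDl.
by rewrite scalerA.
Qed.

Local Fact etens_linearr (V : lmodType C) (x : B) :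
  linear (fun v : V => etens x v).
Proof.
move=> k u v; apply/ffunP => i; rewrite [RHS]ffunE !ffunE scalerDr.
by rewrite !scalerA mulrC.
Qed.

Lemma tens_ractE z y : tens_ract z y = [ffun i => z i ** y].
Proof.
rewrite [RHS]tens_sum; apply: eq_bigr => i _.
by rewrite [in RHS]ffunE.
Qed.

Lemma tens_lact_etens x y v : tens_lact x (etens y v) = etens (x ** y) v.
Proof.
apply: (tlift_etens (f := fun y v => etens (x ** y) v)) => [u|u] k a b.
  by rewrite mulB_linear; exact: etens_linearl.
exact: etens_linearr.
Qed.

Local Fact tens_lact_linear x : linear (tens_lact x).
Proof. by apply: tlift_linear => u k a b; exact: etens_linearr. Qed.

Local Fact tens_lact_linearl z : linear (tens_lact^~ z).
Proof.
move=> k x y; rewrite /tens_lact /tmap /tlift scaler_sumr -big_split.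
by apply: eq_bigr => i _; rewrite mulBr_linear; exact: etens_linearl.
Qed.

Local Fact tens_lactM x y z :
  tens_lact (x ** y) z = tens_lact x (tens_lact y z).
Proof.
rewrite [tens_lact y z]/tens_lact /tmap /tlift.
rewrite (lin_sum (tens_lact_linear x)); apply: eq_bigr => i _.
by rewrite tens_lact_etens amulA.
Qed.

Local Fact tens_ract_linearl y : linear (tens_ract^~ y).
Proof.
move=> k z w; rewrite !tens_ractE; apply/ffunP => i.
by rewrite [RHS]ffunE !ffunE mulBr_linear.
Qed.

Local Fact tens_ract_linearr z : linear (tens_ract z).
Proof.
move=> k x y; rewrite !tens_ractE; apply/ffunP => i.
by rewrite [RHS]ffunE !ffunE mulB_linear.
Qed.

Local Fact tens_ractM z x y :
  tens_ract z (x ** y) = tens_ract (tens_ract z x) y.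
Proof. by rewrite !tens_ractE; apply/ffunP => i; rewrite !ffunE amulA. Qed.

Lemma amulB1 (x : B) : x ** unitB = x.
Proof.
apply: tensP => a p q; rewrite [LHS]tens_mulE (bigD1 q) //= big1 ?addr0.
  by rewrite ffunE eqxx; exact: mulr1.
by move=> r rq; rewrite ffunE /= (negPf rq); exact: mulr0.
Qed.

Lemma amul1B (x : B) : unitB ** x = x.
Proof.
apply: tensP => a p q; rewrite [LHS]tens_mulE (bigD1 p) //= big1 ?addr0.
  by rewrite ffunE eqxx; exact: mul1r.
by move=> r rq; rewrite ffunE /= eq_sym (negPf rq); exact: mul0r.
Qed.

Local Fact tens_ract1 z : tens_ract z unitB = z.
Proof. by rewrite !tens_ractE; apply/ffunP => i; rewrite !ffunE amulB1. Qed.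

Local Fact tens_lact_ract x z y :
  tens_lact x (tens_ract z y) = tens_ract (tens_lact x z) y.
Proof.
rewrite [tens_lact x z]/tens_lact /tmap /tlift.
rewrite (lin_sum (tens_ract_linearl y)); apply: eq_bigr => i _.
rewrite !tens_ractE; apply/ffunP => j.
by rewrite !ffunE amulZl.
Qed.

Lemma tens_inner_linear z : linear (tens_inner z).
Proof.
move=> k u v; rewrite /tens_inner /tsesqui scaler_sumr -big_split.
apply: eq_bigr => i _; rewrite scaler_sumr -big_split; apply: eq_bigr => j _.
by rewrite ![in LHS]ffunE mulB_linear /= scalerDr !scalerA [k * _]mulrC.
Qed.

Lemma psi_star (x : B) : Q (astar x) = ((Q x : C)^* : C^o).
Proof.
pose s : C := Q x; pose t : C := Q (astar x).
have st k : k * s + k^* * t \is Num.real.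
  have := fq_psi_ge0 Q (unitB + k *: x).
  have unitBs : astar unitB = unitB :> B.
    by rewrite -[LHS]amul1B -[X in X ** _]astarK -astarM amul1B astarK.
  rewrite astarD astarZ unitBs amulDl !amulDr !amulZl !amulZr amul1B !amul1B.
  rewrite amulB1 !linearD !linearZ /=.
  set u : C := Q unitB; set n : C := Q (astar x ** x) => q.
  have {}q : 0 <= u + k * s + (k^* * t + k^* * (k * n)) by [].
  have -> : k * s + k^* * t =
      (u + k * s + (k^* * t + k^* * (k * n))) - u - k^* * k * n by ring.
  have u0 : 0 <= u by rewrite /u fq_psi1 ler01.
  rewrite !rpredB ?ger0_real //.
  by rewrite mulr_ge0 ?fq_psi_ge0 // mulrC -normCK exprn_ge0.
have /CrealP := st 'i; have /CrealP := st 1.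
rewrite !(rmorphD, rmorphM) /= !conjCK conjC1 conjCi !mul1r => h1 h2.
have {h2} h2 : t^* - s^* = s - t.
  apply: (mulfI (neq0Ci C)); transitivity (- 'i * s^* + 'i * t^*); first ring.
  by rewrite h2; ring.
suff ts : t^* = s by rewrite -[RHS]/(s^*) -ts conjCK.
apply: (mulfI (x := 2)); first by rewrite pnatr_eq0.
have -> : 2 * t^* = (s^* + t^*) + (t^* - s^*) by ring.
by rewrite h1 h2; ring.
Qed.

Lemma tens_inner_sym z w : astar (tens_inner z w) = tens_inner w z.
Proof.
rewrite /tens_inner /tsesqui astar_sum.
under eq_bigr do rewrite astar_sum.
rewrite exchange_big; apply: eq_bigr => i _; apply: eq_bigr => j _.
by rewrite astarZ astarM astarK -psi_star astarM astarK.
Qed.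

Local Fact tens_inner_ract z w y :
  tens_inner z (tens_ract w y) = tens_inner z w ** y.
Proof.
rewrite tens_ractE /tens_inner /tsesqui amul_suml; apply: eq_bigr => i _.
rewrite amul_suml; apply: eq_bigr => j _.
by rewrite ffunE amulA amulZl.
Qed.

Lemma tens_inner_etens x v y w :
  tens_inner (etens x v) (etens y w) = (Q (astar x ** y) : C) *: (astar v ** w).
Proof.
rewrite [in RHS](munit_sum x) [in RHS](munit_sum y) astar_sum amul_suml.
rewrite linear_sum scaler_suml; apply: eq_bigr => i _.
rewrite amul_sumr linear_sum scaler_suml; apply: eq_bigr => j _.
rewrite !ffunE astarZ amulZl amulZr !linearZ /= astarZ amulZl amulZr !scalerA.
by congr (_ *: _); rewrite linearZ.
Qed.

Local Fact tens_lact_star x z w :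
  tens_inner (tens_lact x z) w = tens_inner z (tens_lact (astar x) w).
Proof.
rewrite -tens_inner_sym [in RHS](tens_sum z) -[RHS]tens_inner_sym.
rewrite {1}/tens_lact /tmap /tlift !(lin_sum (tens_inner_linear _)).
congr astar; apply: eq_bigr => i _.
rewrite -[LHS]tens_inner_sym -[RHS]tens_inner_sym {1}(tens_sum w).
rewrite [in RHS]/tens_lact /tmap /tlift !(lin_sum (tens_inner_linear _)).
congr astar; apply: eq_bigr => j _.
by rewrite !tens_inner_etens astarM amulA.
Qed.

Lemma tens_inner_quad z a (v : 'I_(N a) -> C) :
  \sum_p \sum_q (v p)^* * (tens_inner z z (mi p q) : C) * v q =
  \sum_r (Q (astar (\sum_i (\sum_p v p * z i (mi r p)) *: e i) **
            (\sum_i (\sum_p v p * z i (mi r p)) *: e i)) : C).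
Proof.
pose s i j : C := Q (astar (e i) ** e j).
pose F r i j p q : C :=
  s i j * ((v p)^* * (z i (mi r p) : C)^* * (v q * z j (mi r q))).
transitivity (\sum_r \sum_i \sum_j \sum_p \sum_q F r i j p q).
  transitivity (\sum_p \sum_q \sum_r \sum_i \sum_j F r i j p q).
    apply: eq_bigr => p _; apply: eq_bigr => q _.
    have -> : (tens_inner z z (mi p q) : C) = \sum_r \sum_i \sum_j
        s i j * ((z i (mi r p) : C)^* * z j (mi r q)).
      rewrite [RHS]exchange_big sum_ffunE; apply: eq_bigr => i _.
      rewrite [RHS]exchange_big sum_ffunE; apply: eq_bigr => j _.
      rewrite ffunE [X in _ *: X]ffunE -mulr_sumr; congr (_ * _).
      by apply: eq_bigr => r _; rewrite tens_starE.
    rewrite mulr_sumr mulr_suml; apply: eq_bigr => r _.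
    rewrite mulr_sumr mulr_suml; apply: eq_bigr => i _.
    rewrite mulr_sumr mulr_suml; apply: eq_bigr => j _.
    by rewrite /F; ring.
  under eq_bigr do rewrite exchange_big /=.
  rewrite exchange_big; apply: eq_bigr => r _ /=.
  under eq_bigr do rewrite exchange_big /=.
  rewrite exchange_big; apply: eq_bigr => i _ /=.
  under eq_bigr do rewrite exchange_big /=.
  by rewrite exchange_big.
apply: eq_bigr => r _.
rewrite astar_sum amul_suml (lin_sum (linearP Q)); apply: eq_bigr => i _.
rewrite amul_sumr (lin_sum (linearP Q)); apply: eq_bigr => j _.
rewrite astarZ amulZl amulZr !linearZ /= rmorph_sum /GRing.scale /=.
rewrite mulrA big_distrlr mulr_suml; apply: eq_bigr => p _.
rewrite mulr_suml; apply: eq_bigr => q _.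
by rewrite rmorphM /F mulrC.
Qed.

Local Fact tens_inner_ge0 z : posB (tens_inner z z).
Proof.
move=> a v; rewrite tens_inner_quad; apply: sumr_ge0 => r _.
exact: fq_psi_ge0.
Qed.

Local Fact tens_inner_def z : tens_inner z z = 0 -> z = 0.
Proof.
move=> z0; apply/ffunP => i; rewrite [RHS]ffunE; apply: tensP => a r p.
rewrite [RHS]ffunE; pose v q : C := (q == p)%:R.
have vE j s : \sum_q v q * z j (mi s q) = z j (mi s p).
  rewrite (bigD1 p) //= /v eqxx mul1r big1 ?addr0 // => q qp.
  by rewrite (negPf qp) mul0r.
have := tens_inner_quad z v; rewrite z0 big1; last first.
  move=> s _; rewrite big1 // => q _.
  by rewrite (_ : (0 : B) _ = (0 : C)) ?mulr0 ?mul0r // ffunE.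
move=> /esym/psumr_eq0P => /(_ (fun s _ => fq_psi_ge0 Q _)) /(_ r isT).
move=> /fq_psi_faithful /ffunP /(_ i); rewrite [RHS]ffunE sum_ffunE.
under eq_bigr do rewrite vE ffunE munitE.
move=> zi; transitivity (\sum_j (i == j)%:R *: (z j (mi r p) : C^o)).
  by rewrite (sum_delta (V := C^o)).
by rewrite -[RHS]zi; apply: eq_bigr => j _; exact: mulrC.
Qed.

Definition BpsiB : corr := @Corr (tens N B) tens_inner tens_lact tens_ract
  tens_inner_linear tens_inner_sym tens_inner_ge0 tens_inner_def
  tens_ract_linearl tens_ract_linearr tens_ractM tens_ract1 tens_inner_ract
  tens_lact_linearl tens_lact_linear tens_lactM tens_lact_ract tens_lact_star.

End Internal.

Section Edge.
Context (G : qgraph).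

(* The span of all the x . eps . y: see edge_spaceP.                          *)
Definition edge_space : {vspace BpsiB G} :=
  (\sum_(i : munits N) \sum_(j : munits N)
     <[lact (munit C i) (ract (qg_eps G : BpsiB G) (munit C j))]>)%VS.

Lemma mem_edge_space x y : lact x (ract (qg_eps G : BpsiB G) y) \in edge_space.
Proof.
rewrite (munit_sum x) (lin_sum (lact_linearl _)); apply: rpred_sum => i _.
rewrite (linZ (lact_linearl _)); apply: rpredZ.
rewrite (munit_sum y) (lin_sum (ract_linearr _)) (lin_sum (lact_linearr _)).
apply: rpred_sum => j _.
rewrite (linZ (ract_linearr _)) (linZ (lact_linearr _)); apply: rpredZ.
apply: (subvP (sumv_sup i _ (sumv_sup j _ (subvv _)))) => //.
exact: memv_line.
Qed.

Lemma edge_spaceP (xi : BpsiB G) :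
  xi \in edge_space <->
  exists s : seq (B * B),
    xi = \sum_(u <- s) lact u.1 (ract (qg_eps G : BpsiB G) u.2).
Proof.
split=> [|[s ->]]; last by apply: rpred_sum => u _; exact: mem_edge_space.
pose P (xi : BpsiB G) := exists s : seq (B * B),
  xi = \sum_(u <- s) lact u.1 (ract (qg_eps G : BpsiB G) u.2).
have P0 : P 0 by exists [::]; rewrite big_nil.
have PD u v : P u -> P v -> P (u + v).
  by move=> [s ->] [t ->]; exists (s ++ t); rewrite big_cat.
move=> /memv_sumP[u u_in ->]; apply: (big_ind P) => // i _.
have /memv_sumP[v v_in ->] := u_in i isT; apply: (big_ind P) => // j _.
have /vlineP[k ->] := v_in j isT.
exists [:: (k *: munit C i, munit C j)]; rewrite big_seq1.
exact/esym/(linZ (lact_linearl _)).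
Qed.

Lemma edge_space_lact x (xi : BpsiB G) :
  xi \in edge_space -> lact x xi \in edge_space.
Proof.
move=> /edge_spaceP[s ->]; rewrite (lin_sum (lact_linearr _)).
by apply: rpred_sum => u _; rewrite -lactM; exact: mem_edge_space.
Qed.

Lemma edge_space_ract (xi : BpsiB G) y :
  xi \in edge_space -> ract xi y \in edge_space.
Proof.
move=> /edge_spaceP[s ->]; rewrite (lin_sum (ract_linearl _)).
by apply: rpred_sum => u _; rewrite -lact_ract -ractM; exact: mem_edge_space.
Qed.

Definition edge_corr : corr := subcorr edge_space_lact edge_space_ract.

End Edge.

Section CuntzPimsner.
Context (X : corr).
Implicit Types (x : B) (xi eta zeta : X).

Definition theta xi eta : X -> X := fun zeta => ract xi (cinner eta zeta).

(* X being finite dimensional, the span of the theta's is closed.             *)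
Definition compact_op (k : X -> X) : Prop :=
  exists s : seq (X * X), forall zeta,
    k zeta = \sum_(u <- s) theta u.1 u.2 zeta.

Definition katsura_ideal x : Prop :=
  compact_op (lact x) /\
  (forall y : B, (forall xi, lact y xi = 0) -> x ** y = 0).

Definition representation (D : starAlgType C) (pi : B -> D) (t : X -> D) :
  Prop :=
  [/\ star_hom pi, linear t,
      forall x xi, pi x ** t xi = t (lact x xi)
    & forall xi eta, astar (t xi) ** t eta = pi (cinner xi eta)].

(* The values of psit outside the compact operators are irrelevant; on these  *)
(* psit is determined by linearity and the last clause.                       *)
Definition induced_hom (D : starAlgType C) (t : X -> D) (psit : (X -> X) -> D) :
  Prop :=
  [/\ forall (c : C) k l, compact_op k -> compact_op l ->
        psit (fun zeta => c *: k zeta + l zeta) = c *: psit k + psit l,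
      forall k l, compact_op k -> compact_op l ->
        psit (k \o l) = psit k ** psit l,
      forall k l, compact_op k -> compact_op l ->
        (forall xi eta, cinner (k xi) eta = cinner xi (l eta)) ->
        psit l = astar (psit k)
    & forall xi eta, psit (theta xi eta) = t xi ** astar (t eta)].

Definition covariant (D : starAlgType C) (pi : B -> D) (t : X -> D) : Prop :=
  representation pi t /\
  exists psit, induced_hom t psit /\
    (forall x, katsura_ideal x -> pi x = psit (lact x)).

(* D is the smallest C*-subalgebra containing the ranges of pi and t.         *)
Definition generates (D : cstarAlgType C) (pi : B -> D) (t : X -> D) : Prop :=
  forall S : set D,
    closed S ->
    S 0 ->
    (forall (k : C) a b, S a -> S b -> S (k *: a + b)) ->
    (forall a b, S a -> S b -> S (a ** b)) ->
    (forall a, S a -> S (astar a)) ->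
    (forall x, S (pi x)) ->
    (forall xi, S (t xi)) ->
    forall a, S a.

Definition universal_covariant (O : cstarAlgType C) (pi : B -> O) (t : X -> O) :
  Prop :=
  covariant pi t /\
  (forall (D : cstarAlgType C) (pi' : B -> D) (t' : X -> D), covariant pi' t' ->
    exists sigma : O -> D, [/\ star_hom sigma,
      forall x, sigma (pi x) = pi' x & forall xi, sigma (t xi) = t' xi]).

Definition cuntz_pimsner (O : cstarAlgType C) : Prop :=
  exists (pi : B -> O) (t : X -> O), generates pi t /\ universal_covariant pi t.

End CuntzPimsner.

End QuantumGraph.

(* Main.v *)
Require Import Defs.
From HB Require Import structures.
From mathcomp Require Import all_boot all_order all_algebra.
From mathcomp Require Import cyclic separable cyclotomic sesquilinear spectral.
From mathcomp Require Import all_classical all_reals all_analysis.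
From mathcomp Require Import complex ring lra zify.

(* As [(psi (y . -) (x) id) (m^* 1) = y], the inner product of the edge
   correspondence satisfies
   [<x eps y, x' eps y'> = delta^-2 (x T^* y)^* (x' T^* y')], so that
   [x eps y |-> delta^-1 x T^* y] identifies it with [B T^* B = B], seen as the
   identity correspondence: it is generated by a central [u] with [<u, u> = 1].
   A covariant representation [(pi, t)] then amounts to [pi] and a unitary
   [t u] of the corner [pi 1] that commutes with [pi B], and the universal one
   lives on [B (x) C(T)], with [u] going to [1 (x) z].

   The functional calculus [C(T) -> D] of a unitary [v] of a corner of [D]
   needs [|p(v)| <= sup |p|] for a Laurent polynomial [p]. For [h = p^* p], the
   coefficients of [h^n] are at most [sup |h|^n] and there are O(n) of them, so
   [|h(v)|^n = |h(v)^n| <= O(n) sup |h|^n] for [n = 2^k], and [n] tends to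
   infinity. Laurent polynomials are dense in [C(T)] by Fejer interpolation.

   Finally, for an arbitrary Cuntz-Pimsner algebra [O], the map
   [B (x) C(T) -> O] is bounded below, hence injective with closed range, and
   its range contains the generators. *)

Set Implicit Arguments.
Unset Strict Implicit.
Unset Printing Implicit Defensive.

Import Order.TTheory GRing.Theory Num.Theory numFieldNormedType.Exports.

Local Open Scope classical_set_scope.
Local Open Scope ring_scope.

(** * Complex numbers *)

Section ComplexAnalysis.
Variable R : realType.
Local Notation C := R[i].
Local Open Scope complex_scope.

(** The trace condition on [T] is what makes the inner product of [x eps y] and [x' eps y'] depend
    only on [x T^* y] and [x' T^* y'], and a nonzero entry of [T] in every block is what puts [1] in
    [B T^* B]. The obstacle lies in the lower bound for [B (x) C(T) -> O]. The universal property
    supplies a map [sigma : O -> B (x) C(T)], but a [star_hom] is not assumed continuous, so norms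
    cannot simply be pushed through it. It is used algebraically instead: followed by the evaluation
    of a diagonal entry at a point [w], it gives a character of [C(T)] that sends [z] to [w]. If
    [|f w|] exceeded the norm of the image of [f], then cutting [|f|^2] off below a suitable level
    would give a nonnegative function that is positive at [w] but has image zero in [O]. The
    character kills that function, and also [|z - w|^2], although their sum is invertible. Since all
    of this is done inside a diagonal corner, one commutative argument serves every entry of every
    block. *)

Lemma normc_le_ReIm (z : C) : `|z| <= (`|complex.Re z| + `|complex.Im z|)%:C.
Proof.
rewrite {1}(complexE z) rmorphD /= (le_trans (ler_normD _ _))//.
rewrite lerD //; first by rewrite normc_def /= expr0n /= addr0 sqrtr_sqr.
by rewrite normrM !normc_def /= expr0n /= !addr0 add0r expr1n sqrtr1 mul1r
  sqrtr_sqr.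
Qed.

Lemma normc_ge_Im (z : C) : `|complex.Im z|%:C <= `|z|.
Proof.
have -> : complex.Im z = - complex.Re (z * 'i%C) by rewrite ReiNIm opprK.
rewrite normrN (le_trans (normc_ge_Re _)) // normrM [X in _ * X]normc_def /=.
by rewrite expr0n expr1n add0r sqrtr1 mulr1.
Qed.

Lemma real_complex_continuous : continuous (fun t : R => t%:C : C^o).
Proof.
move=> t; apply/cvgrPdist_lt => e e0.
have [/eqP eR e0'] : complex.Im e = 0 /\ 0 < complex.Re e.
  by move: e0; rewrite ltcE => /andP[/eqP -> ?].
near=> s.
rewrite -rmorphB normc_def /= expr0n addr0 sqrtr_sqr -(RRe_real (gtr0_real e0)).
rewrite ltcR; near: s; exact: cvgr_dist_lt.
Unshelve. all: by end_near. Qed.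

Lemma complex_complete (F : set_system C^o) :
  ProperFilter F -> cauchy F -> exists l : C, F --> (l : C^o).
Proof.
move=> FF /cauchyP Fc.
have sub (p : C -> R) : (forall z w, `|p z - p w|%:C <= `|z - w|) ->
    exists l : R, p @ F --> l.
  move=> pl; exists (lim (p @ F)); apply: cauchy_cvg.
  apply/cauchyP => e e0; have e0' : 0 < e%:C by rewrite ltcR.
  have [z Fz] := Fc _ e0'; exists (p z).
  apply: (@filterS _ F _ (ball (z : C^o) e%:C)) Fz => w;
    rewrite -!ball_normE /= => zw.
  by have := le_lt_trans (pl _ _) zw; rewrite ltcR.
have [|r rP] := sub (@complex.Re R).
  by move=> z w; rewrite -raddfB; exact: normc_ge_Re.
have [|s sP] := sub (@complex.Im R).
  by move=> z w; rewrite -raddfB; exact: normc_ge_Im.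
exists (r +i* s); apply/cvgrPdist_lt => e e0.
have eR := RRe_real (gtr0_real e0).
have e2 : 0 < complex.Re e / 2 by rewrite divr_gt0 // -ltcR eR.
have /cvgrPdist_lt /(_ _ e2) rF := rP; have /cvgrPdist_lt /(_ _ e2) sF := sP.
near=> z; have : `|r - complex.Re z| + `|s - complex.Im z| < complex.Re e.
  rewrite (splitr (complex.Re e)) ltrD //; near: z; [exact: rF|exact: sF].
rewrite -ltcR eR; apply: le_lt_trans.
rewrite -[r in X in _ <= X]/(complex.Re (r +i* s)).
by rewrite (le_trans (normc_le_ReIm _)) // raddfB raddfB.
Unshelve. all: by end_near. Qed.

(** Inverse stereographic projection from [-i], a rational parametrisation that carries [[-1, 1]]
    onto the closed upper half circle; the parameter of [x + i y] is [x / (1 + y)]. *)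
Definition arc (t : R) : C^o := 'i%C * (1 - 'i%C * t%:C) / (1 + 'i%C * t%:C).

Lemma arc_den (t : R) : 1 + 'i%C * t%:C != 0 :> C.
Proof. by rewrite eq_complex /=; simpc; rewrite /= oner_eq0. Qed.

Lemma arc_continuous : continuous arc.
Proof.
move=> t; have ct : (fun s : R =>
  ('i%C * s%:C : C^o)) @ t --> ('i%C * t%:C : C^o).
  apply: (@cvgM C _ _ _ (fun=> 'i%C) (fun s => s%:C : C^o));
    first exact: cvg_cst.
  exact: real_complex_continuous.
apply: (@cvgM C _ _ _ (fun s => 'i%C * (1 - 'i%C * s%:C)) (fun s =>
  (1 + 'i%C * s%:C)^-1)).
  apply: (@cvgM C _ _ _ (fun=> 'i%C) (fun s => 1 - 'i%C * s%:C));
    first exact: cvg_cst.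
  exact: (@cvgB C C^o _ _ _ (fun=> 1) _ _ _ (cvg_cst _) ct).
apply: (@cvgV C _ _ _ (fun s => 1 + 'i%C * s%:C)); first exact: arc_den.
exact: (@cvgD C C^o _ _ _ (fun=> 1) _ _ _ (cvg_cst _) ct).
Qed.

Lemma arc_circle t : `|arc t| = 1.
Proof.
rewrite /arc normf_div normrM.
have -> : `|'i%C| = 1 :> C by rewrite normc_def /= expr0n expr1n add0r sqrtr1.
rewrite mul1r; set a := (X in X / _); set b := (X in _ / X).
suff -> : a = b by rewrite divff // normr_eq0 arc_den.
by rewrite /a /b !normc_def /=; simpc; rewrite /= ?sqrrN.
Qed.

Lemma arc_surj (z : C) : `|z| = 1 -> 0 <= complex.Im z ->
  exists2 t, -1 <= t <= 1 & arc t = z.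
Proof.
case: z => x y z1 /= y0.
have xy : x ^+ 2 + y ^+ 2 = 1.
  by apply: complexI; have := add_Re2_Im2 (x +i* y); rewrite z1 expr1n.
have y1 : 1 + y != 0 by rewrite gt_eqF // ltr_wpDr.
exists (x / (1 + y)).
  rewrite -ler_norml normrM normfV ler_pdivrMr ?normr_gt0 // mul1r.
  have y0' : 0 <= 1 + y by rewrite addr_ge0.
  by rewrite [leRHS]ger0_norm // -ler_sqr ?nnegrE // real_normK ?num_real //;
    nra.
apply: (mulIf (arc_den (x / (1 + y)))); rewrite /arc mulfVK ?arc_den //.
set t := x / (1 + y).
have h1 : t * (1 + y) = x by rewrite mulfVK.
have h2 : t * x = 1 - y.
  by apply: (mulIf y1); rewrite mulrAC h1; nra.
simpc; congr (_ +i* _); nra.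
Qed.

End ComplexAnalysis.

(** * The circle *)

Section CircleTopology.
Variable R : realType.
Local Notation C := R[i].
Local Notation circle := (@circle C).
Local Notation Ccircle := (Ccircle C).
Implicit Types (z w : circle) (f g : Ccircle).
Local Open Scope complex_scope.

Definition cval z : C := set_val z.

Lemma norm_cval z : `|cval z| = 1.
Proof. exact: (@set_valP C^o (@Defs.circle C) z). Qed.

Lemma cval_inj : injective cval.
Proof. exact: val_inj. Qed.

Definition Circle (x : C) (x1 : `|x| = 1) : circle :=
  SigSub (mem_set x1 : x \in @Defs.circle C).

Lemma CircleK x (x1 : `|x| = 1) : cval (Circle x1) = x.
Proof. by []. Qed.

Lemma nbhs_circleP z (A : set circle) :
  nbhs z A <-> exists2 e : C, 0 < e & forall w, `|cval z - cval w| < e -> A w.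
Proof.
split=> [[_ /= [[W oW <-] /= Wz WA]]|[e e0 eA]].
  have /nbhs_ballP[e /= e0 eW] : nbhs (set_val z : C^o) W.
    by rewrite nbhsE; exists W.
  by exists e => // w zw; apply/WA/eW; rewrite -ball_normE.
exists (set_val @^-1` (ball (set_val z : C^o) e)^°).
split; first by exists ((ball (set_val z : C^o) e)^°) => //;
  exact: open_interior.
  by apply: nbhsx_ballx.
by move=> w /= /interior_subset; rewrite -ball_normE => /eA.
Qed.

Lemma cval_continuous : continuous (fun z => cval z : C^o).
Proof.
by move=> z; apply/(@cvgrPdist_lt C C^o _ _ (nbhs_filter z)) => e e0;
  apply/nbhs_circleP; exists e.
Qed.

Lemma circle_compact : compact [set: circle].
Proof.
(* The lower half circle is the negative of the upper one, so the two signs of [arc] on [[-1, 1]]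
   cover the circle. *)
pose g (s : bool) (t : R) : circle :=
  Circle (etrans (normrMsign _ _) (arc_circle t) : `|(-1) ^+ s * arc t| = 1).
have gc s : continuous (g s).
  move=> t; have := @arc_continuous R t =>
    /cvgrPdist_lt h A /nbhs_circleP[e e0 eA].
  apply: filterS (h _ e0) => u au; apply: eA;
    rewrite !CircleK -mulrBr normrMsign.
  exact: au.
have -> : [set: circle] = (g false @` `[-1, 1]) `|` (g true @` `[-1, 1]).
  apply/seteqP; split=> // z _.
  have [z0|z0] := leP 0 (complex.Im (cval z)).
    have [t t1 tz] := arc_surj (norm_cval z) z0.
    by left; exists t; [rewrite /= in_itv|apply: cval_inj;
      rewrite CircleK mul1r].
  have [||t t1 tz] := @arc_surj _ (- cval z); first by rewrite normrN norm_cval.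
    by rewrite raddfN oppr_ge0 ltW.
  right; exists t; [by rewrite /= in_itv|apply: cval_inj].
  by rewrite CircleK tz mulN1r opprK.
apply: compactU; apply: continuous_compact;
  by [apply: continuous_subspaceT; exact: gc|exact: segment_compact].
Qed.

Lemma Ccircle_unif_continuous f (e : C) : 0 < e ->
  exists2 r : C, 0 < r & forall z w, `|cval z - cval w| < r -> `|f z - f w| < e.
Proof.
move=> e0; have := circle_compact; rewrite compact_near_coveringP.
(* Radii are encoded as [|r|] with [r] near 0: the near-covering form of compactness then turns
   radii that work near each point into one that works everywhere. At [r = 0] the condition is
   vacuous, so [r / 2] is taken in the end. *)
move=> /(_ C^o (nbhs (0 : C^o)) (fun r z =>
  forall w, `|cval z - cval w| < `|r| -> `|f z - f w| < e)).
case=> [z _|r /= r0 rP].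
- have /(@cvgrPdist_lt C C^o _ _ (nbhs_filter z)) /(_ _ (divr_gt0 e0 (ltr0Sn C
  1))) /nbhs_circleP[d d0 dP] :=
    (@cts_fun _ _ f z : f @ z --> (f z : C^o)).
  have d2 : 0 < d / 2 by rewrite divr_gt0.
  exists ([set w | `|cval z - cval w| < d / 2], [set r : C^o | `|r| < d / 2]).
    split; first by apply/nbhs_circleP; exists (d / 2).
    by apply/nbhs_ballP; exists (d / 2) => // r;
      rewrite -ball_normE /= sub0r normrN.
  case=> x r [/= zx rd] w xw; rewrite -(subrKA (f z)) (splitr e).
  rewrite (le_lt_trans (ler_normD _ _)) // ltrD //.
    by rewrite distrC; apply: dP; apply: lt_trans zx _;
      rewrite gtr_pMr // invf_lt1 // ltr1n.
  apply: dP; rewrite -(subrKA (cval x)) (splitr d) (le_lt_trans (ler_normD _ _))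
    // ltrD //.
  exact: lt_trans xw rd.
- exists (r / 2); first by rewrite divr_gt0.
  move=> z w zw; apply: (rP (r / 2)) => //;
    last by rewrite [in ltRHS]gtr0_norm ?divr_gt0.
  by rewrite /ball_ /= sub0r normrN gtr0_norm ?divr_gt0 // gtr_pMr //
    invf_lt1 // ltr1n.
Qed.

Lemma Ccircle_bounded f : exists2 K : C, 0 <= K & forall z, `|f z| <= K.
Proof.
have := circle_compact; rewrite compact_near_coveringP.
move=> /(_ C^o (nbhs (0 : C^o)) (fun r z => `|r| * `|f z| <= 1)).
case=> [z _|r /= r0 rP].
- have /(@cvgrPdist_lt C C^o _ _ (nbhs_filter z)) /(_ _ ltr01) Uz :=
  (@cts_fun _ _ f z : f @ z --> (f z : C^o)).
  have K0 : 0 < (`|f z| + 1)^-1 :> C by rewrite invr_gt0 ltr_wpDl.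
  exists ([set w | `|f z - f w| < 1], [set r : C^o | `|r| < (`|f z| + 1)^-1]).
    split=> //.
    by apply/nbhs_ballP; exists (`|f z| + 1)^-1 => // r;
      rewrite -ball_normE /= sub0r normrN.
  case=> x r [/= zx rd].
  rewrite -[leRHS](@mulVf _ (`|f z| + 1)) ?gt_eqF ?ltr_wpDl //.
  rewrite ler_pM ?(ltW rd) // -[f x](subrK (f z)) addrC (le_trans (ler_normD _
    _)) //.
  by rewrite lerD2l distrC ltW.
- exists (r / 2)^-1; first by rewrite invr_ge0 ltW // divr_gt0.
  move=> z; rewrite -[leRHS]mulr1 ler_pdivlMl ?divr_gt0 //.
  rewrite -[X in X * _]gtr0_norm ?divr_gt0 //; apply: rP => //.
  by rewrite /ball_ /= sub0r normrN gtr0_norm ?divr_gt0 // gtr_pMr //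
    invf_lt1 // ltr1n.
Qed.

End CircleTopology.

(** * Laurent polynomials *)

Section StarAlgebraSub.
Context (C : numClosedFieldType) (A : starAlgType C).
Implicit Types x y z : A.

Lemma amulBr x y z : x ** (y - z) = x ** y - x ** z.
Proof. by rewrite amulDr -[- z]scaleN1r amulZr scaleN1r. Qed.

Lemma amulBl x y z : (x - y) ** z = x ** z - y ** z.
Proof. by rewrite amulDl -[- y]scaleN1r amulZl scaleN1r. Qed.

Lemma astarB x y : astar (x - y) = astar x - astar y.
Proof. by rewrite astarD -[- y]scaleN1r astarZ rmorphN1 scaleN1r. Qed.

End StarAlgebraSub.

Section StarHomTheory.
Context (C : numClosedFieldType) (A D : starAlgType C) (h : A -> D).
Hypothesis h_hom : star_hom h.

Lemma star_hom_linear : linear h. Proof. by case: h_hom. Qed.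
Lemma star_homM x y : h (x ** y) = h x ** h y. Proof. by case: h_hom. Qed.
Lemma star_hom_star x : h (astar x) = astar (h x). Proof. by case: h_hom. Qed.
Lemma star_homD x y : h (x + y) = h x + h y. Proof.
  exact: linD star_hom_linear _ _. Qed.
Lemma star_homZ k x : h (k *: x) = k *: h x. Proof.
  exact: linZ star_hom_linear _ _. Qed.
Lemma star_hom_sum I (r : seq I) P (F : I -> A) :
  h (\sum_(i <- r | P i) F i) = \sum_(i <- r | P i) h (F i).
Proof. exact: lin_sum star_hom_linear _ _ _ _. Qed.

End StarHomTheory.

Section Laurent.
Context (C : numClosedFieldType).
Implicit Types (A D : starAlgType C).

(** As algebras need not be unital, a unitary lives in the corner of a projection [e], which plays
    the part of its zeroth power. The relation [v ** e = v] follows from the others. *)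
Definition corner_unitary A (e v : A) : Prop :=
  [/\ e ** e = e, astar e = e, astar v ** v = e, v ** astar v = e & e ** v = v].

Definition vpow A (e v : A) (j : int) : A :=
  match j with
  | Posz n => iter n (amul v) e
  | Negz n => iter n.+1 (amul (astar v)) e
  end.

(* The pair [(c, j)] stands for the monomial [c z^j]. *)
Definition lpoly := seq (C * int).

Definition leval A (e v : A) (s : lpoly) : A :=
  \sum_(p <- s) p.1 *: vpow e v p.2.

Definition lmul (s t : lpoly) : lpoly :=
  [seq (p.1 * q.1, p.2 + q.2) | p <- s, q <- t].
Definition lstar (s : lpoly) : lpoly := [seq (p.1^*, - p.2) | p <- s].
Definition lscale (k : C) (s : lpoly) : lpoly := [seq (k * p.1, p.2) | p <- s].

Section Eval.
Context A (e v : A) (uv : corner_unitary e v).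

Lemma corner_unitaryr : v ** e = v.
Proof. by case: uv => _ _ <- vv ev; rewrite amulA vv. Qed.

Lemma vpow_unitl j : e ** vpow e v j = vpow e v j.
Proof.
case: uv => ee es _ _ ev.
have ves : e ** astar v = astar v by rewrite -[X in X ** _]es -astarM
  corner_unitaryr.
by case: j => [[|n]|n] /=; rewrite ?ee // amulA ?ev ?ves.
Qed.

Lemma vpowS j : vpow e v (j + 1) = v ** vpow e v j.
Proof.
case: j => [n|[|n]]; first by rewrite -PoszD addn1.
  by rewrite /= amulA; case: uv => ee _ _ -> _; rewrite ee.
have -> : Negz n.+1 + 1 = Negz n by rewrite !NegzE -addn1 PoszD opprD addrNK.
rewrite [RHS]/= [in RHS]amulA; case: (uv) => _ _ _ -> _.
exact: esym (vpow_unitl (Negz n)).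
Qed.

Lemma vpowB1 j : vpow e v (j - 1) = astar v ** vpow e v j.
Proof.
rewrite -[X in _ = _ ** vpow _ _ X](subrK 1) vpowS amulA.
by case: uv => _ _ -> _ _; rewrite vpow_unitl.
Qed.

Lemma vpowD i j : vpow e v (i + j) = vpow e v i ** vpow e v j.
Proof.
elim: i => [|n IH|n IH]; first by rewrite add0r vpow_unitl.
  by rewrite -addn1 PoszD addrAC !vpowS IH amulA.
by rewrite -addn1 PoszD opprD addrAC !vpowB1 IH amulA.
Qed.

Lemma vpow1 : vpow e v 1 = v. Proof. exact: corner_unitaryr. Qed.

Lemma vpowN1 : vpow e v (- 1) = astar v.
Proof. by rewrite /= -[X in _ ** X](let: And5 _ es _ _ _ := uv in es) -astarM;
  case: uv => _ _ _ _ ->. Qed.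

Lemma vpow_star j : astar (vpow e v j) = vpow e v (- j).
Proof.
elim: j => [|n IH|n IH]; first by case: uv.
  by rewrite -addn1 PoszD vpowS astarM IH opprD vpowD vpowN1.
by rewrite -addn1 PoszD opprD vpowB1 astarM IH astarK !opprD !opprK vpowD vpow1.
Qed.

Lemma leval_cat s t : leval e v (s ++ t) = leval e v s + leval e v t.
Proof. exact: big_cat. Qed.

Lemma leval_scale k s : leval e v (lscale k s) = k *: leval e v s.
Proof.
rewrite /leval big_map scaler_sumr; apply: eq_bigr => p _.
by rewrite scalerA.
Qed.

Lemma leval_mul s t : leval e v (lmul s t) = leval e v s ** leval e v t.
Proof.
rewrite /leval /lmul big_allpairs_dep amul_suml; apply: eq_bigr => p _.
rewrite amul_sumr; apply: eq_bigr => q _.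
by rewrite vpowD amulZl amulZr scalerA.
Qed.

Lemma leval_star s : leval e v (lstar s) = astar (leval e v s).
Proof.
rewrite /leval big_map astar_sum; apply: eq_bigr => p _.
by rewrite astarZ vpow_star.
Qed.

End Eval.

Lemma star_hom_vpow A D (h : A -> D) (e v : A) j : star_hom h ->
  h (vpow e v j) = vpow (h e) (h v) j.
Proof.
move=> hh; case: j => n /=; rewrite ?(star_homM hh) ?(star_hom_star hh).
  by elim: n => //= n IH; rewrite (star_homM hh) IH.
by congr (_ ** _); elim: n => //= n IH;
  rewrite (star_homM hh) (star_hom_star hh) IH.
Qed.

Lemma star_hom_leval A D (h : A -> D) (e v : A) s : star_hom h ->
  h (leval e v s) = leval (h e) (h v) s.
Proof.
move=> hh; rewrite (star_hom_sum hh); apply: eq_bigr => p _.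
by rewrite (star_homZ hh) star_hom_vpow.
Qed.

Lemma vpow_comm A (e v x : A) j : x ** e = e ** x -> x ** v = v ** x ->
  x ** astar v = astar v ** x -> x ** vpow e v j = vpow e v j ** x.
Proof.
move=> xe xv xvs; have com n u : x ** u = u ** x ->
    x ** iter n (amul u) e = iter n (amul u) e ** x.
  by move=> xu; elim: n => //= n IH; rewrite amulA xu -amulA IH amulA.
by case: j => n; exact: com.
Qed.

Lemma leval_comm A (e v x : A) s : x ** e = e ** x -> x ** v = v ** x ->
  x ** astar v = astar v ** x -> x ** leval e v s = leval e v s ** x.
Proof.
move=> xe xv xvs; rewrite amul_suml amul_sumr; apply: eq_bigr => p _.
by rewrite amulZl amulZr vpow_comm.
Qed.

Lemma circle_unitary (z : C) : `|z| = 1 -> corner_unitary (1 : C^o) (z : C^o).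
Proof.
move=> z1; have zz : z * z^* = 1 by rewrite -normCK z1 expr1n.
split; [exact: mul1r|exact: conjC1|by rewrite -[LHS]/(z^* * z)
  mulrC|exact: zz|exact: mul1r].
Qed.

Lemma vpow_circle (z : C) j : `|z| = 1 -> vpow (1 : C^o) (z : C^o) j = z ^ j.
Proof.
move=> z1; have zV : z^* = z^-1 by rewrite invC_norm z1 expr1n invr1 mul1r.
case: j => n; first by elim: n => //= n IH; rewrite IH; exact: esym (exprS _ _).
rewrite [in RHS]NegzE -exprnN -exprVn -zV /vpow.
by elim: n.+1 => //= k IH; rewrite IH; exact: esym (exprS _ _).
Qed.

Definition lz (s : lpoly) (z : C) : C := \sum_(p <- s) p.1 * z ^ p.2.

(** A scalar of modulus 1 is a unitary of the algebra of scalars, so the product and adjoint rules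
    for [leval] yield those for pointwise values. *)
Lemma lzE s (z : C) : `|z| = 1 -> lz s z = leval (1 : C^o) (z : C^o) s.
Proof. by move=> z1; apply: eq_bigr => p _; rewrite vpow_circle. Qed.

Lemma lz_cat s t z : lz (s ++ t) z = lz s z + lz t z.
Proof. exact: big_cat. Qed.

Lemma lz_scale k s z : lz (lscale k s) z = k * lz s z.
Proof. by rewrite /lz big_map mulr_sumr; apply: eq_bigr => p _;
  rewrite mulrA. Qed.

Lemma lz_mul s t z : `|z| = 1 -> lz (lmul s t) z = lz s z * lz t z.
Proof. by move=> z1; rewrite !lzE // (leval_mul (circle_unitary z1)). Qed.

Lemma lz_star s z : `|z| = 1 -> lz (lstar s) z = (lz s z)^*.
Proof. by move=> z1; rewrite !lzE // (leval_star (circle_unitary z1)). Qed.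

(** In characteristic zero [X^n - 1] is separable, hence has [n] distinct roots, and [n] distinct
    [n]-th roots of unity include a primitive one. *)
Lemma prim_root_exists n : (0 < n)%N -> exists z : C, n.-primitive_root z.
Proof.
move=> n0; pose p : {poly C} := 'X^n - 1.
have [r Dp] := closed_field_poly_normal p; move: Dp.
rewrite (monicP _) ?monicXnsubC // scale1r => Dp.
have rn1 : all n.-unity_root r by apply/allP => z; rewrite -root_prod_XsubC -Dp.
have rn : (n < (size r).+1)%N by rewrite -(size_prod_XsubC r id) -Dp
  size_XnsubC.
have [|z] := hasP (has_prim_root n0 rn1 _ rn); last by exists z.
by rewrite -separable_prod_XsubC -Dp separable_Xn_sub_1 // pnatr_eq0 -lt0n.
Qed.

Lemma prim_root_norm n (w : C) : n.-primitive_root w -> `|w| = 1.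
Proof.
move=> wP; have n0 := prim_order_gt0 wP.
by apply/eqP; rewrite -(pexpr_eq1 n0 (normr_ge0 w)) -normrX (prim_expr_order wP)
  normr1.
Qed.

Lemma norm_circle_expz (z : C) (j : int) : `|z| = 1 -> `|z ^ j| = 1.
Proof.
by move=> z1; case: j => n; rewrite ?NegzE -?exprnN ?normfV normrX z1 expr1n
  ?invr1.
Qed.

(** Orthogonality of the characters of a cyclic group: for [|j| < n] the power [w ^ j] is 1 only if
    [j = 0], and otherwise the geometric sum vanishes. *)
Lemma sum_prim_root n (w : C) (j : int) : n.-primitive_root w -> (`|j| < n)%N ->
  \sum_(k < n) (w ^+ k) ^ j = (j == 0)%:R * n%:R.
Proof.
move=> wP jn; have w1 := prim_root_norm wP.
have w0 : w != 0 by rewrite -normr_gt0 w1.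
under eq_bigr do rewrite exprnP exprz_exp mulrC -exprz_exp -exprnP.
have [->|j0] := eqVneq.
  by under eq_bigr do rewrite expr1n; rewrite sumr_const card_ord mul1r.
have wj : w ^ j != 1.
  have wn m : (0 < m < n)%N -> w ^+ m != 1.
    move=> /andP[m0 mn]; rewrite -(prim_order_dvd wP);
      apply/negP => /(dvdn_leq m0).
    by rewrite leqNgt mn.
  case: j jn j0 => m /= jn j0; first by apply: wn; rewrite jn andbT lt0n.
  by rewrite NegzE -exprnN invr_eq1 wn // jn.
have := subrX1 (w ^ j) n; rewrite exprnP exprz_exp mulrC -exprz_exp -exprnP.
rewrite (prim_expr_order wP) exp1rz subrr => /esym/eqP;
  rewrite mulf_eq0 subr_eq0 (negPf wj) /=.
by move=> /eqP ->; rewrite mul0r.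
Qed.

(** A list may repeat an exponent, so the coefficient collects all occurrences. *)
Definition lcoef (s : lpoly) (j : int) : C := \sum_(p <- s) (p.2 == j)%:R * p.1.

Definition ldeg (n : nat) (s : lpoly) : bool := all (fun p => `|p.2| <= n)%N s.

(** The coefficient is the average of [z ^ (- j) * lz s z] over the roots of unity of order
    [2n + 1], a discrete substitute for the Fourier integral. It is exact because two exponents in
    [[-n, n]] differ by at most [2n]. *)
Lemma lcoef_bound n s (K : C) j : ldeg n s -> (`|j| <= n)%N ->
  (forall z : C, `|z| = 1 -> `|lz s z| <= K) -> `|lcoef s j| <= K.
Proof.
move=> sn jn sK; have [w wP] := prim_root_exists (ltn0Sn n.*2).
have w1 := prim_root_norm wP.
have w1k k : `|w ^+ k| = 1 by rewrite normrX w1 expr1n.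
have wk0 k : w ^+ k != 0 by rewrite -normr_gt0 w1k.
have m0 : 0 < n.*2.+1%:R :> C by rewrite ltr0n.
rewrite -(ler_pM2r m0) -{1}(ger0_norm (ltW m0)) -normrM.
have -> : lcoef s j * n.*2.+1%:R = \sum_(k < n.*2.+1) (w ^+ k) ^ (- j) * lz s (w
  ^+ k).
  under [RHS]eq_bigr do rewrite mulr_sumr.
  rewrite exchange_big mulr_suml !big_seq; apply: eq_bigr => p ps /=.
  under eq_bigr => k _ do rewrite mulrCA -(expfzDr _ _ (wk0 k)).
  rewrite -mulr_sumr sum_prim_root //.
    by rewrite addrC subr_eq0 mulrA [p.1 * _]mulrC.
  have := allP sn _ ps; move: jn; rewrite /=; lia.
rewrite (le_trans (ler_norm_sum _ _ _)) //.
have -> : K * n.*2.+1%:R = \sum_(k < n.*2.+1) K by rewrite sumr_const card_ord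
  mulr_natr.
by apply: ler_sum => k _; rewrite normrM norm_circle_expz // mul1r sK.
Qed.

Lemma leval_coef n s A (e v : A) : ldeg n s ->
  leval e v s = \sum_(l < n.*2.+1) lcoef s (l%:Z - n%:Z) *: vpow e v (l%:Z -
    n%:Z).
Proof.
move=> sn; under eq_bigr do rewrite scaler_suml.
rewrite exchange_big /leval !big_seq; apply: eq_bigr => -[c j] /(allP sn) /= jn.
have ln : (absz (j + n%:Z)%R < n.*2.+1)%N by lia.
rewrite (bigD1 (Ordinal ln)) //= big1 ?addr0.
  have -> : (absz (j + n%:Z))%:Z - n%:Z = j by lia.
  by rewrite eqxx mul1r.
move=> l; rewrite -val_eqE /= => /negPf lp.
case: eqP => [jl|_]; last by rewrite mul0r scale0r.
by move: lp; rewrite jl; lia.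
Qed.

Lemma ldeg_mul n m s t : ldeg n s -> ldeg m t -> ldeg (n + m) (lmul s t).
Proof.
move=> sn tm; apply/allP => _ /allpairsP[[[c i] [b j]] [/(allP sn) /= ps /(allP
  tm) /= qt ->]] /=.
lia.
Qed.

Lemma ldeg_star n s : ldeg n s -> ldeg n (lstar s).
Proof. by move=> sn; apply/allP => _ /mapP[p /(allP sn) /= pn ->] /=;
  rewrite abszN. Qed.

Lemma ldeg_exists s : exists n, ldeg n s.
Proof.
exists (\sum_(p <- s) `|p.2|)%N; apply/allP => p ps.
by rewrite (big_rem p) //= leq_addr.
Qed.

End Laurent.

(** * Contractivity of the evaluation of Laurent polynomials at a unitary *)

Section Growth.
Variable R : realType.
Local Notation C := R[i].
Local Open Scope complex_scope.

(** If [x / y = 1 + r] with [r > 0], Bernoulli's inequality at exponent [N = 2^k], once squared,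
    bounds [(N r)^2] by the linear term [2 a N + 1] of exponent [2N]. Hence [N r^2 <= 2 a + 1] for
    every such [N], against the Archimedean property. *)
Lemma real_power_growth (x y : R) (a : nat) : 0 <= x -> 0 <= y ->
  (forall k, x ^+ (2 ^ k) <= (a * 2 ^ k).+1%:R * y ^+ (2 ^ k)) -> x <= y.
Proof.
move=> x0 y0 xy; rewrite leNgt; apply/negP => yx.
have [y_eq0|y_neq0] := eqVneq y 0.
  by have := xy 0%N; rewrite y_eq0 !expr1 mulr0 leNgt (le_lt_trans y0 yx).
have y_gt0 : 0 < y by rewrite lt_neqAle eq_sym y_neq0.
pose q := x / y; pose r := q - 1.
have r0 : 0 < r by rewrite subr_gt0 ltr_pdivlMr // mul1r.
have qk k : q ^+ (2 ^ k) <= (a * 2 ^ k).+1%:R.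
  by rewrite expr_div_n ler_pdivrMr ?exprn_gt0.
have bern n : 1 + n%:R * r <= q ^+ n.
  elim: n => [|n IH]; first by rewrite mul0r addr0.
  have q0 : 0 <= q by rewrite divr_ge0.
  have qE : q = 1 + r by rewrite addrC subrK.
  rewrite exprS (le_trans _ (ler_wpM2l q0 IH)) // [X in _ <= X * _]qE -natr1.
  have : 0 <= n%:R * r * r by rewrite !mulr_ge0 ?ler0n ?ltW.
  by move=> h; rewrite -subr_ge0 (_ : _ - _ = n%:R * r * r) //; ring.
have key k : (2 ^ k)%:R * r ^+ 2 <= (2 * a + 1)%:R.
  have N0 : 0 < (2 ^ k)%:R :> R by rewrite ltr0n expn_gt0.
  have Nr : 0 <= (2 ^ k)%:R * r by rewrite mulr_ge0 ?ltW.
  have b1 : (2 ^ k)%:R * r <= q ^+ (2 ^ k) by rewrite (le_trans _ (bern _)) //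
    lerDr.
  have : ((2 ^ k)%:R * r) ^+ 2 <= (a * 2 ^ k.+1).+1%:R.
    rewrite (le_trans _ (qk k.+1)) // expnSr exprM.
    by rewrite ler_pXn2r ?nnegrE // (le_trans Nr).
  move=> h; rewrite -(ler_pM2r N0).
  have -> : (2 ^ k)%:R * r ^+ 2 * (2 ^ k)%:R = ((2 ^ k)%:R * r) ^+ 2 by ring.
  rewrite (le_trans h) // -natrM ler_nat expnS mulnA [(a * 2)%N]mulnC.
  by rewrite mulnDl mul1n -addn1 leq_add2l expn_gt0.
have r20 : 0 < r ^+ 2 by rewrite exprn_gt0.
have := archi_boundP (ltW (divr_gt0 (ltr0Sn R (2 * a)) r20)).
set n := Num.bound _; rewrite ltr_pdivrMr // ltNge => /negP; apply.
rewrite -[(2 * a).+1]addn1 (le_trans _ (key n)) // ler_wpM2r ?(ltW r20) //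
  ler_nat.
exact/ltnW/ltn_expl.
Qed.

Lemma complex_nat_bound (x : C) : 0 <= x -> exists n : nat, x <= n.+1%:R.
Proof.
move=> x0; have xR := RRe_real (ger0_real x0).
exists (Num.bound (complex.Re x)).
rewrite -xR -(rmorph_nat (real_complex R)) lecR -natr1 ler_wpDr //.
by rewrite ltW // archi_boundP // -ler0c xR.
Qed.

Lemma power_growth (x y : C) (a : nat) : 0 <= x -> 0 <= y ->
  (forall k, x ^+ (2 ^ k) <= (a * 2 ^ k).+1%:R * y ^+ (2 ^ k)) -> x <= y.
Proof.
move=> x0 y0 xy; have xR := RRe_real (ger0_real x0);
  have yR := RRe_real (ger0_real y0).
rewrite -xR -yR lecR; apply: (@real_power_growth _ _ a) => [||k].
- by rewrite -ler0c xR.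
- by rewrite -ler0c yR.
have := xy k; rewrite -xR -yR -(rmorph_nat (real_complex R)).
by rewrite -!rmorphXn -rmorphM lecR.
Qed.

End Growth.

Section Contractive.
Variable R : realType.
Local Notation C := R[i].
Variables (D : cstarAlgType C) (e v : D).
Hypothesis uv : corner_unitary e v.

Lemma norm_astar (x : D) : `|astar x| = `|x|.
Proof.
have le (y : D) : `|y| <= `|astar y|.
  have [->|y0] := eqVneq y 0; first by rewrite astar0.
  have y1 : 0 < `|y| by rewrite normr_gt0.
  by rewrite -(ler_pM2r y1) -expr2 -norm_cstar norm_amul.
by apply/eqP; rewrite eq_le le -{2}[x]astarK le.
Qed.

Lemma norm_proj (p : D) : p ** p = p -> astar p = p -> `|p| <= 1.
Proof.
move=> pp ps; have := norm_cstar p; rewrite ps pp => h.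
have [->|p0] := eqVneq p 0; first by rewrite normr0.
have p1 : 0 < `|p| by rewrite normr_gt0.
by rewrite -(ler_pM2r p1) mul1r -expr2 -h.
Qed.

Lemma norm_corner : `|e| <= 1.
Proof. by case: uv => ee es _ _ _; exact: norm_proj. Qed.

Lemma norm_vpow j : `|vpow e v j| <= 1.
Proof.
have v1 : `|v| <= 1.
  rewrite -(@expr_le1 _ 2) // -norm_cstar; case: (uv) => _ _ -> _ _.
  exact: norm_corner.
have it (u : D) n : `|u| <= 1 -> `|iter n (amul u) e| <= 1.
  move=> u1; elim: n => [|n IH]; first exact: norm_corner.
  by rewrite (le_trans (norm_amul _ _)) // mulr_ile1.
by case: j => n; apply: it; rewrite ?norm_astar.
Qed.

Lemma norm_leval_crude n s (K : C) : ldeg n s ->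
  (forall z : C, `|z| = 1 -> `|lz s z| <= K) ->
  `|leval e v s| <= n.*2.+1%:R * K.
Proof.
move=> sn sK; rewrite (leval_coef _ _ sn) (le_trans (ler_norm_sum _ _ _)) //.
have -> : n.*2.+1%:R * K = \sum_(l < n.*2.+1) K.
  by rewrite sumr_const card_ord mulr_natl.
apply: ler_sum => l _; rewrite normrZ (le_trans (ler_piMr _ (norm_vpow _))) //.
apply: (lcoef_bound sn) => //; have := ltn_ord l; lia.
Qed.

Lemma norm_leval s (K : C) : 0 <= K ->
  (forall z : C, `|z| = 1 -> `|lz s z| <= K) -> `|leval e v s| <= K.
Proof.
move=> K0 sK; have [n sn] := ldeg_exists s.
(* [t k] is [(p^* p)^(2^k)]. Its value at [v] is self-adjoint, so the C*-identity makes each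
   squaring square the norm exactly. *)
pose t k := iter k (fun t => lmul t t) (lmul (lstar s) s).
have tn k : ldeg (n.*2 * 2 ^ k) (t k).
  elim: k => [|k IH]; first by rewrite muln1 -addnn ldeg_mul ?ldeg_star.
  by rewrite expnS [(2 * _)%N]mulnC mulnA muln2 -addnn ldeg_mul.
have tK k z : `|z| = 1 -> `|lz (t k) z| <= (K ^+ 2) ^+ (2 ^ k).
  move=> z1; elim: k => [|k IH] /=.
    rewrite expr1 lz_mul // lz_star // normrM norm_conjC -expr2.
    by rewrite ler_pXn2r ?nnegrE // sK.
  by rewrite lz_mul // normrM -expr2 expnSr exprM ler_pXn2r ?nnegrE ?exprn_ge0.
have tsa k : astar (leval e v (t k)) = leval e v (t k).
  elim: k => [|k IH] /=; rewrite !(leval_mul uv) ?(leval_star uv) astarM ?astarK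
    //.
  by rewrite IH.
have tN k : `|leval e v (t k)| = (`|leval e v s| ^+ 2) ^+ (2 ^ k).
  elim: k => [|k IH] /=; rewrite (leval_mul uv) ?(leval_star uv) ?norm_cstar //.
  by rewrite -{1}tsa norm_cstar IH expnSr exprM.
rewrite -(@ler_pXn2r _ 2) ?nnegrE //.
(* The degree of [t k] is at most [2n 2^k], so [4n 2^k + 1] coefficients suffice in the crude
   bound. *)
apply: (@power_growth _ _ _ n.*2.*2); rewrite ?exprn_ge0 // => k.
rewrite -tN (le_trans (norm_leval_crude (tn k) (tK k))) //.
by rewrite -!muln2 mulnAC.
Qed.

End Contractive.

(** * Density of the Laurent polynomials in [C(T)] *)

Section Fejer.
Variable R : realType.
Local Notation C := R[i].
Local Notation Ccircle := (Ccircle C).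

Lemma lz_flatten (I : Type) (r : seq I) (F : I -> lpoly C) z :
  lz (flatten [seq F i | i <- r]) z = \sum_(i <- r) lz (F i) z.
Proof.
elim: r => [|i r IH] /=; first by rewrite /lz !big_nil.
by rewrite lz_cat IH big_cons.
Qed.

Lemma inv_unit_circle (z : C) : `|z| = 1 -> z^-1 = z^*.
Proof. by move=> z1; rewrite invC_norm z1 expr1n invr1 mul1r. Qed.

(** Expanding the squares gives the terms [z^(j - l) (w^k)^(l - j)]. Summed over [k], those with
    [j <> l] vanish by orthogonality, and each of the [m] diagonal ones contributes [m]. *)
Lemma fejer_partition m (w z : C) : m.-primitive_root w -> `|z| = 1 ->
  \sum_(k < m) `|\sum_(j < m) (z / w ^+ k) ^+ j| ^+ 2 = m%:R ^+ 2.
Proof.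
move=> wP z1; have w1 := prim_root_norm wP; have n0 := prim_order_gt0 wP.
have zu : z != 0 by rewrite -normr_gt0 z1.
have wu k : w ^+ k != 0 by rewrite -normr_gt0 normrX w1 expr1n.
have term (k j l : 'I_m) : (z / w ^+ k) ^+ j * ((z / w ^+ k) ^+ l)^* =
    z ^ (j%:Z - l%:Z) * (w ^+ k) ^ (l%:Z - j%:Z).
  have q1 : `|z / w ^+ k| = 1 by rewrite normf_div normrX w1 expr1n divr1.
  have qu : z / w ^+ k != 0 by rewrite -normr_gt0 q1.
  rewrite rmorphXn /= -inv_unit_circle // exprVn exprnN exprnP.
  rewrite -expfzDr // expfzMl -[(w ^+ k)^-1]/((w ^+ k) ^ (-1)).
  by congr (_ * _); rewrite exprz_exp mulN1r opprB.
under eq_bigr => k _.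
  rewrite normCK rmorph_sum mulr_suml.
  under eq_bigr => j _ do (rewrite mulr_sumr;
    under eq_bigr => l _ do rewrite term).
  over.
rewrite exchange_big /=; under eq_bigr do rewrite exchange_big /=.
under eq_bigr => j _.
  under eq_bigr => l _.
    rewrite -mulr_sumr sum_prim_root //; last by have := ltn_ord j;
      have := ltn_ord l; lia.
    over.
  rewrite (bigD1 j) //= subrr expr0z eqxx !mul1r big1 ?addr0; last first.
    move=> l; rewrite -val_eqE /= => lj.
    by rewrite subr_eq0 eqz_nat (negPf lj) mul0r mulr0.
  over.
by rewrite sumr_const card_ord -[LHS]mulr_natr expr2.
Qed.

(** Multiplied by [x - 1], the geometric sum becomes [x^m - 1], of modulus at most 2. *)
Lemma fejer_far m (x r : C) : `|x| = 1 -> 0 < r -> r <= `|x - 1| ->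
  `|\sum_(j < m) x ^+ j| ^+ 2 <= 4 / r ^+ 2.
Proof.
move=> x1 r0 rx; rewrite ler_pdivlMr ?exprn_gt0 // -exprMn (_ : 4 = 2 ^+ 2);
  last by ring.
rewrite ler_pXn2r ?nnegrE ?mulr_ge0 ?(ltW r0) // mulrC.
apply: le_trans (ler_wpM2r (normr_ge0 _) rx) _.
by rewrite -normrM -subrX1 (le_trans (ler_normB _ _)) //
  normrX x1 expr1n normr1.
Qed.

(* Fejer interpolation at the m-th roots of unity: the kernels
   K_k(z) = |sum_(j < m) (z / w^k)^j|^2 / m^2 are nonnegative, sum to 1, and
   are O(1/m^2) away from w^k. *)
Lemma laurent_dense (f : Ccircle) (e : C) : 0 < e ->
  exists s, forall z, `|f z - lz s (cval z)| <= e.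
Proof.
move=> e0; have e2 : 0 < e / 2 by rewrite divr_gt0.
have [r r0 fr] := Ccircle_unif_continuous f e2.
have [K K0 fK] := Ccircle_bounded f.
(* A node at distance at least [r] contributes at most [4 / (r^2 m^2)] times [2 K]; [m] such terms
   stay below [e / 2] as soon as [m >= 16 K / (e r^2)]. *)
have [n] := complex_nat_bound (divr_ge0 (mulr_ge0 (ler0n _ 16) K0)
  (ltW (mulr_gt0 e0 (exprn_gt0 2 r0)))).
set m := n.+1 => mK; have [w wP] := prim_root_exists C (ltn0Sn n).
have w1 := prim_root_norm wP.
have wk1 k : `|w ^+ k| = 1 by rewrite normrX w1 expr1n.
have m0 : 0 < m%:R :> C by rewrite ltr0n.
pose q k : lpoly C := [seq (((w ^+ k) ^+ j)^-1, j%:Z) | j <- iota 0 m].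
pose kern k z : C := `|\sum_(j < m) (z / w ^+ k) ^+ j| ^+ 2 / m%:R ^+ 2.
have qE k z : lz (q k) z = \sum_(j < m) (z / w ^+ k) ^+ j.
  rewrite /lz big_map -[iota 0 m]/(index_iota 0 m) big_mkord;
    apply: eq_bigr => j _.
  by rewrite expr_div_n mulrC.
pose fw k : C := f (Circle (wk1 k)).
pose s := flatten [seq lscale (fw k / m%:R ^+ 2)
  (lmul (q k) (lstar (q k))) | k <- iota 0 m].
exists s => z.
have z1 := norm_cval z.
have -> : lz s (cval z) = \sum_(k < m) kern k (cval z) * fw k.
  rewrite lz_flatten -[iota 0 m]/(index_iota 0 m) big_mkord;
    apply: eq_bigr => k _.
  rewrite lz_scale lz_mul // lz_star // -normCK qE /kern.
  by rewrite [LHS]mulrAC [RHS]mulrC [RHS]mulrA.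
have kern_ge0 k : 0 <= kern k (cval z) by rewrite divr_ge0 ?exprn_ge0.
have kern_sum : \sum_(k < m) kern k (cval z) = 1.
  by rewrite -mulr_suml fejer_partition // divff // expf_neq0 // gt_eqF.
rewrite -[X in X - _](mul1r (f z : C)) -{1}kern_sum mulr_suml -sumrB.
rewrite (le_trans (ler_norm_sum _ _ _)) //.
apply: (@le_trans _ _ (\sum_(k < m) (kern k (cval z) * (e / 2) +
    8 * K / (r ^+ 2 * m%:R ^+ 2)))).
  apply: ler_sum => k _; rewrite -mulrBr normrM ger0_norm //.
  have [zw|/negP zw] := boolP (`|cval z - w ^+ k| < r).
    rewrite ler_wpDr ?divr_ge0 ?mulr_ge0 ?exprn_ge0 ?(ltW r0) ?ler0n //.
    rewrite ler_wpM2l //; exact: ltW (fr z (Circle (wk1 k)) zw).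
  have {}zw : r <= `|cval z - w ^+ k|.
    by rewrite (real_leNgt (gtr0_real r0) (normr_real _)); apply/negP.
  apply: (@le_trans _ _ (8 * K / (r ^+ 2 * m%:R ^+ 2)));
    last by rewrite lerDr mulr_ge0 // ltW.
  have -> : 8 * K / (r ^+ 2 * m%:R ^+ 2) = 4 / r ^+ 2 / m%:R ^+ 2 * (2 * K).
    by field; rewrite !gt_eqF.
  rewrite ler_pM //; last first.
    rewrite (le_trans (ler_normB _ _)) // (_ : 2 * K = K + K); last by ring.
    by apply: lerD; exact: fK.
  rewrite ler_wpM2r ?invr_ge0 ?exprn_ge0 ?(ltW m0) // fejer_far //.
    by rewrite normf_div z1 wk1 divr1.
  have wu : w ^+ k != 0 by rewrite -normr_gt0 wk1.
  rewrite (_ : cval z / w ^+ k - 1 = (cval z - w ^+ k) / w ^+ k); last by field.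
  by rewrite normf_div wk1 divr1.
rewrite big_split /= -mulr_suml kern_sum mul1r sumr_const card_ord
  -[leRHS](addrNK (e / 2)).
rewrite addrC lerD2r -mulr_natr.
have -> : e - e / 2 = e / 2 by field.
move: mK; rewrite ler_pdivrMr ?mulr_gt0 ?exprn_gt0 // => mK.
rewrite -(ler_pM2r (mulr_gt0 (exprn_gt0 2 r0) m0)).
apply: (@le_trans _ _ (8 * K)).
  by rewrite le_eqVlt; apply/orP; left; apply/eqP; field; rewrite !gt_eqF.
have -> : 8 * K = 16 * K / 2 by field.
have -> : e / 2 * (r ^+ 2 * m%:R) = m%:R * (e * r ^+ 2) / 2 by field.
by rewrite ler_wpM2r // invr_ge0 ler0n.
Qed.

End Fejer.

(** * Functional calculus of a unitary *)

Section Approximation.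
Variable R : realType.
Local Notation C := R[i].

Definition harm (n : nat) : C := n.+1%:R^-1.

Lemma harm_gt0 n : 0 < harm n.
Proof. by rewrite invr_gt0 ltr0n. Qed.

Lemma harm_small (e : C) : 0 < e -> exists N, forall n, (N <= n)%N -> harm n <=
  e.
Proof.
move=> e0; have [N hN] := complex_nat_bound (ltW (etrans (invr_gt0 e) e0)).
exists N => n Nn; rewrite -[e]invrK lef_pV2 ?posrE ?invr_gt0 ?ltr0n //.
by rewrite (le_trans hN) // ler_nat.
Qed.

(** Completeness with an explicit rate that survives in the limit. It serves both to build the
    functional calculus and to show that the range of [B (x) C(T) -> O] is closed. *)
Lemma harm_limit (V : completeNormedModType C) (u : nat -> V) (K : C) : 0 <=
  K ->
  (forall m n, `|u m - u n| <= K * (harm m + harm n)) ->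
  exists l, forall n, `|l - u n| <= K * harm n.
Proof.
move=> K0 uK; have K1 : 0 < K + 1 by rewrite ltr_wpDl.
have Ksmall e : 0 < e -> exists N, forall n, (N <= n)%N -> K * harm n <= e.
  move=> e0; have [N hN] := harm_small (divr_gt0 e0 K1).
  exists N => n /hN; rewrite ler_pdivlMr // mulrC; apply: le_trans.
  by rewrite ler_wpM2r ?(ltW (harm_gt0 _)) // lerDl.
have uc : cauchy (u @ \oo).
  apply/cauchyP => e e0; have [N hN] := Ksmall _ (divr_gt0 e0 (ltr0Sn C 2)).
  exists (u N); exists N => //= n Nn; rewrite -ball_normE /=.
  rewrite (le_lt_trans (uK _ _)) //
    mulrDr (le_lt_trans (lerD (hN _ (leqnn N)) (hN _ Nn))) //.
  rewrite [ltRHS](_ : e = e / 3 + e / 3 + e / 3); last by field.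
  by rewrite ltrDl divr_gt0.
have ucv : cvg (u @ \oo) by exact: cauchy_cvg.
exists (lim (u @ \oo)) => n; apply/ler_addgt0Pr => e e0.
have e2 : 0 < e / 2 by rewrite divr_gt0.
have [M _ hM] := (cvgrPdist_lt u (lim (u @ \oo))).1 ucv _ e2.
have [N hN] := Ksmall _ e2.
rewrite -(subrKA (u (maxn M N))) (le_trans (ler_normD _ _)) //.
rewrite [leRHS](_ : _ = e / 2 + (e / 2 + K * harm n)); last by field.
apply: lerD; first by rewrite ltW // hM //= leq_maxl.
by rewrite (le_trans (uK _ _)) // mulrDr lerD2r hN // leq_maxr.
Qed.

End Approximation.

Section CircleFunctions.
Variable R : realType.
Local Notation C := R[i].
Local Notation Ccircle := (Ccircle C).

Definition zeta : Ccircle := mkcts (@cval_continuous R).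
Definition oneT : Ccircle := cst (1 : C^o).

Lemma eval_star_hom z : star_hom (fun f : Ccircle => f z : C^o).
Proof. by []. Qed.

Lemma eval_sum (I : Type) (r : seq I) (F : I -> Ccircle) z :
  (\sum_(i <- r) F i) z = \sum_(i <- r) (F i z : C).
Proof. exact: (star_hom_sum (eval_star_hom z)). Qed.

Lemma zeta_unitary : corner_unitary oneT zeta.
Proof.
have zz (z : @Defs.circle C) : cval z * (cval z)^* = 1.
  by rewrite -normCK norm_cval expr1n.
split; apply/continuousEP => z;
  [exact: mul1r|exact: conjC1|rewrite -[RHS](zz z)|exact: zz|exact: mul1r].
exact: mulrC.
Qed.

Lemma leval_zeta s z : leval oneT zeta s z = lz s (cval z).
Proof.
by rewrite (star_hom_leval _ _ s (eval_star_hom z)) -lzE // norm_cval.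
Qed.

End CircleFunctions.

Section FunctionalCalculus.
Variable R : realType.
Local Notation C := R[i].
Local Notation Ccircle := (Ccircle C).
Variables (D : cstarAlgType C) (e v : D).
Hypothesis uv : corner_unitary e v.
Implicit Types (f g : Ccircle) (x y : D).

(** The closure of the graph of Laurent evaluation: one Laurent polynomial approximates [f]
    uniformly and [x] in norm. As a relation it inherits the algebraic rules from the approximants,
    before any limit is chosen; it is shown to be a function afterwards. *)
Definition fcrel f x := forall r : C, 0 < r -> exists s : lpoly C,
  (forall z, `|f z - lz s (cval z)| <= r) /\ `|x - leval e v s| <= r.

Lemma norm_leval_circle s (K : C) : 0 <= K ->
  (forall z, `|lz s (cval z)| <= K) -> `|leval e v s| <= K.
Proof.
move=> K0 sK; apply: (norm_leval uv) => // z z1.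
by rewrite -(CircleK z1).
Qed.

Lemma fcrel_norm f x (K : C) : 0 <= K -> fcrel f x ->
  (forall z, `|f z| <= K) -> `|x| <= K.
Proof.
move=> K0 fx fK; apply/ler_addgt0Pr => r r0.
have r2 : 0 < r / 2 by rewrite divr_gt0.
have [s [fs xs]] := fx _ r2; rewrite -[x](subrK (leval e v s)).
rewrite (le_trans (ler_normD _ _)) // (splitr r) addrC addrA lerD //.
apply: norm_leval_circle => [|z]; first by rewrite addr_ge0 // ltW.
rewrite -[lz _ _](subrK (f z : C)) addrC (le_trans (ler_normD _ _)) // lerD //.
by rewrite distrC fs.
Qed.

Lemma fcrel_leval s : fcrel (leval (oneT R) (zeta R) s) (leval e v s).
Proof.
move=> r r0; exists s; rewrite subrr normr0 ltW //; split=> // z.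
by rewrite leval_zeta subrr normr0 ltW.
Qed.

Lemma fcrelD f g x y : fcrel f x -> fcrel g y -> fcrel (f + g) (x + y).
Proof.
move=> fx gy r r0; have r2 : 0 < r / 2 by rewrite divr_gt0.
have [s [fs xs]] := fx _ r2; have [t [gt yt]] := gy _ r2.
exists (s ++ t); rewrite leval_cat (splitr r); split=> [z|]; last first.
  by rewrite opprD addrACA (le_trans (ler_normD _ _)) // lerD.
rewrite lz_cat -[(f + g) z]/((f z : C) + g z) opprD addrACA.
by rewrite (le_trans (ler_normD _ _)) // lerD.
Qed.

Lemma fcrelZ k f x : fcrel f x -> fcrel (k *: f) (k *: x).
Proof.
move=> fx r r0; have k1 : 0 < `|k| + 1 :> C by rewrite ltr_wpDl.
have small (a : C) : 0 <= a -> a <= r / (`|k| + 1) -> `|k| * a <= r.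
  move=> a0; rewrite ler_pdivlMr // mulrC; apply: le_trans.
  by rewrite ler_wpM2r // lerDl.
have [s [fs xs]] := fx _ (divr_gt0 r0 k1).
exists (lscale k s); rewrite leval_scale -scalerBr normrZ small //;
  split=> // z.
by rewrite lz_scale -[(k *: f) z]/(k * (f z : C)) -mulrBr normrM;
  apply: small => //; exact: fs.
Qed.

Lemma fcrelM f g x y : fcrel f x -> fcrel g y -> fcrel (f ** g) (x ** y).
Proof.
move=> fx gy r r0; have [Kf Kf0 fK] := Ccircle_bounded f.
have [Kg Kg0 gK] := Ccircle_bounded g.
have xK := fcrel_norm Kf0 fx fK.
have c0 : 0 < Kf + Kg + 1 + r by rewrite ltr_wpDl // !addr_ge0.
(* The summand [r] of the denominator forces [q <= 1], so that [Kf q + q (Kg + q) <= (Kf + Kg + 1) q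
   <= r]. *)
pose q := r / (Kf + Kg + 1 + r).
have q0 : 0 < q by rewrite divr_gt0.
have q1 : q <= 1 by rewrite ler_pdivrMr // mul1r lerDr !addr_ge0.
have qr : Kf * q + q * (Kg + q) <= r.
  have -> : r = (Kf + Kg + 1 + r) * q by rewrite /q mulrC divfK // gt_eqF.
  rewrite -subr_ge0.
  have -> : (Kf + Kg + 1 + r) * q - (Kf * q + q * (Kg + q)) =
      q * (1 - q) + q * r by ring.
  by apply: addr_ge0; apply: mulr_ge0; rewrite ?subr_ge0 // ltW.
have [s [fs xs]] := fx _ q0; have [t [gt yt]] := gy _ q0.
have tK z : `|lz t (cval z)| <= Kg + q.
  rewrite -[lz _ _](subrK (g z : C)) addrC (le_trans (ler_normD _ _)) //
    lerD //.
  by rewrite distrC gt.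
exists (lmul s t); split=> [z|].
  rewrite lz_mul ?norm_cval // -[(f ** g) z]/((f z : C) * g z).
  have -> : (f z : C) * g z - lz s (cval z) * lz t (cval z) =
    (f z : C) * ((g z : C) - lz t (cval z)) +
      ((f z : C) - lz s (cval z)) * lz t (cval z).
    by ring.
  rewrite (le_trans (ler_normD _ _)) // (le_trans _ qr) // lerD // normrM.
    by apply: ler_pM => //; exact: fK.
  by apply: ler_pM => //; (exact: fs || exact: tK).
rewrite (leval_mul uv) (_ : _ - _ = x ** (y - leval e v t) +
  (x - leval e v s) ** leval e v t).
  rewrite (le_trans (ler_normD _ _)) // (le_trans _ qr) // lerD //.
    by apply: le_trans (norm_amul _ _) _; apply: ler_pM.
  apply: le_trans (norm_amul _ _) _; apply: ler_pM => //.
  by apply: norm_leval_circle; rewrite // addr_ge0 // ltW.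
by rewrite amulBr amulBl addrA addrNK.
Qed.

Lemma fcrel_star f x : fcrel f x -> fcrel (astar f) (astar x).
Proof.
move=> fx r r0; have [s [fs xs]] := fx _ r0.
exists (lstar s); split=> [z|].
  rewrite lz_star ?norm_cval // -[astar f z]/((f z : C)^*) -rmorphB norm_conjC.
  exact: fs.
by rewrite (leval_star uv) -astarB norm_astar.
Qed.

(** By linearity [x - y] is related to the zero function, and the relation is contractive. *)
Lemma fcrel_uniq f x y : fcrel f x -> fcrel f y -> x = y.
Proof.
move=> fx fy; apply/eqP; rewrite -subr_eq0 -normr_le0.
have := fcrelD fx (fcrelZ (- 1) fy); rewrite !scaleN1r => fxy.
apply: (fcrel_norm (lexx 0) fxy) => z.
by rewrite subrr normr0.
Qed.

(** Contractivity turns uniform approximants of [f] into a Cauchy sequence in [D]. *)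
Lemma fcrel_ex f : exists x, fcrel f x.
Proof.
have [s sP] := choice (fun n => laurent_dense f (harm_gt0 R n)).
have [|x xP] := @harm_limit R D (fun n => leval e v (s n)) 1 ler01.
  move=> m n; rewrite mul1r -scaleN1r -leval_scale -leval_cat.
  apply: norm_leval_circle => [|z];
    first by rewrite addr_ge0 // ltW // harm_gt0.
  rewrite lz_cat lz_scale mulN1r -(subrKA (f z : C)) (le_trans (ler_normD _ _))
    // lerD //.
  by rewrite distrC sP.
exists x => r r0; have [N hN] := harm_small r0.
exists (s N); split=> [z|]; first by rewrite (le_trans (sP _ _)) // hN.
by rewrite (le_trans (xP _)) // mul1r hN.
Qed.

Definition fcalc f : D := projT1 (cid (fcrel_ex f)).

Lemma fcalcP f : fcrel f (fcalc f).
Proof. exact: projT2 (cid _). Qed.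

Lemma fcalc_hom : star_hom fcalc.
Proof.
split=> [k f g|f g|f]; apply: fcrel_uniq (fcalcP _) _.
- by apply: fcrelD (fcalcP _); apply: fcrelZ; exact: fcalcP.
- by apply: fcrelM; exact: fcalcP.
- by apply: fcrel_star; exact: fcalcP.
Qed.

Lemma fcalc_leval s : fcalc (leval (oneT R) (zeta R) s) = leval e v s.
Proof. exact: fcrel_uniq (fcalcP _) (fcrel_leval s). Qed.

Lemma fcalc1 : fcalc (oneT R) = e.
Proof.
have := fcalc_leval [:: (1, 0)]; rewrite /leval !big_seq1 !scale1r.
exact.
Qed.

Lemma fcalc_zeta : fcalc (zeta R) = v.
Proof.
have := fcalc_leval [:: (1, 1)]; rewrite /leval !big_seq1 !scale1r.
by rewrite (vpow1 uv) (vpow1 (zeta_unitary R)).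
Qed.

Lemma norm_fcalc f (K : C) : 0 <= K -> (forall z, `|f z| <= K) -> `|fcalc f| <=
  K.
Proof. by move=> K0; apply: fcrel_norm => //; exact: fcalcP. Qed.

Lemma fcalc_comm f x : x ** e = e ** x -> x ** v = v ** x ->
  x ** astar v = astar v ** x -> x ** fcalc f = fcalc f ** x.
Proof.
move=> xe xv xvs; apply/eqP; rewrite -subr_eq0 -normr_le0;
  apply/ler_addgt0Pr => r r0.
have c0 : 0 < 2 * (`|x| + 1) :> C by rewrite mulr_gt0 // ltr_wpDl.
have [s [_ fs]] := fcalcP f (divr_gt0 r0 c0).
set y := fcalc f in fs *; set t := leval e v s in fs *.
have -> : x ** y - y ** x = x ** (y - t) - (y - t) ** x.
  by rewrite amulBr amulBl (leval_comm s xe xv xvs) opprB addrA subrK.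
rewrite add0r (le_trans (ler_normB _ _)) //.
rewrite (le_trans (lerD (norm_amul _ _) (norm_amul _ _))) //
  [X in _ + X]mulrC -mulr2n -mulr_natl.
rewrite mulrA; move: fs; rewrite ler_pdivlMr // mulrC; apply: le_trans.
by rewrite ler_wpM2r // ler_wpM2l // lerDl.
Qed.

End FunctionalCalculus.

(** * The C*-algebra B (x) C(T) *)

Section VectorNorm.
Variables (C : numClosedFieldType) (n : nat).
Implicit Types (u w : 'rV[C]_n) (X : 'M[C]_n).

Definition vnorm u : C := sqrtC (dotmx u u).

Lemma dotmx_sum u w : dotmx u w = \sum_k u 0 k * (w 0 k)^*.
Proof. by rewrite dotmxE mxE; apply: eq_bigr => k _; rewrite !mxE. Qed.

Lemma vnorm_ge0 u : 0 <= vnorm u.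
Proof. exact: sqrt_dnorm_ge0. Qed.

Lemma vnorm_sqr u : vnorm u ^+ 2 = dotmx u u.
Proof. exact: sqrtCK. Qed.

Lemma vnorm_eq0 u : (vnorm u == 0) = (u == 0).
Proof. exact: sqrt_dnorm_eq0. Qed.

Lemma vnormD u w : vnorm (u + w) <= vnorm u + vnorm w.
Proof. by case: (triangle_lerif (@dotmx C n) u w). Qed.

Lemma vnormZ k u : vnorm (k *: u) = `|k| * vnorm u.
Proof.
by rewrite /vnorm dnormZ sqrtCM ?nnegrE ?exprn_ge0 ?dnorm_ge0 // sqrCK.
Qed.

Lemma vnorm_sum I (r : seq I) P (F : I -> 'rV[C]_n) :
  vnorm (\sum_(i <- r | P i) F i) <= \sum_(i <- r | P i) vnorm (F i).
Proof.
elim/big_ind2 : _ => // [|a u b w ha hb].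
  by rewrite le_eqVlt vnorm_eq0 eqxx.
by rewrite (le_trans (vnormD _ _)) // lerD.
Qed.

Lemma dotmx_le u w : `|dotmx u w| <= vnorm u * vnorm w.
Proof. by case: (CauchySchwarz_sqrt (@dotmx C n) u w). Qed.

Lemma vnorm_delta i : vnorm (delta_mx 0 i) = 1.
Proof.
rewrite /vnorm dotmx_sum (bigD1 i) //= big1 => [|k ki]; rewrite mxE ?eqxx /=.
  by rewrite conjC1 mulr1 addr0 sqrtC1.
by rewrite (negPf ki) mul0r.
Qed.

Lemma vnorm_coord u i : `|u 0 i| <= vnorm u.
Proof.
rewrite -(@ler_pXn2r _ 2) ?nnegrE ?vnorm_ge0 //
  vnorm_sqr dotmx_sum (bigD1 i) //= -normCK.
by rewrite lerDl sumr_ge0 // => k _; rewrite -normCK exprn_ge0.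
Qed.

Lemma vnorm_mulmx u X (K : C) : 0 <= K -> (forall p q, `|X p q| <= K) ->
  vnorm (u *m X) <= (n * n)%:R * K * vnorm u.
Proof.
move=> K0 XK.
have -> : u *m X = \sum_p \sum_q (u 0 p * X p q) *: delta_mx 0 q.
  rewrite exchange_big [LHS]row_sum_delta; apply: eq_bigr => q _.
  by rewrite -scaler_suml mxE.
apply: le_trans (vnorm_sum _ _ _) _.
have -> : (n * n)%:R * K * vnorm u = \sum_(p < n) \sum_(q < n) K * vnorm u.
  by rewrite !sumr_const !card_ord -mulrnA -[in RHS]mulr_natl mulrA.
apply: ler_sum => p _; apply: le_trans (vnorm_sum _ _ _) _.
apply: ler_sum => q _; rewrite vnormZ vnorm_delta mulr1 normrM mulrC.
by rewrite ler_pM ?vnorm_coord.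
Qed.

End VectorNorm.

Local Opaque vnorm.

Section MatrixFunctions.
Variables (R : realType) (d : nat) (N : 'I_d -> nat).
Local Notation C := R[i].
Local Notation M := (tens N (Ccircle C)).
Local Notation circle := (@Defs.circle C).
Implicit Types (x y : M) (z : circle).
Local Open Scope complex_scope.

Definition fiber x z a : 'M[C]_(N a) := \matrix_(p, q) x (mi p q) z.

Lemma fiberM x y z a : fiber (x ** y) z a = fiber x z a *m fiber y z a.
Proof.
apply/matrixP => p q; rewrite !mxE [(x ** y) _]tens_mulE eval_sum.
by apply: eq_bigr => r _; rewrite !mxE.
Qed.

Lemma fiberD x y z a : fiber (x + y) z a = fiber x z a + fiber y z a.
Proof. by apply/matrixP => p q; rewrite !mxE ffunE. Qed.

Lemma fiberZ k x z a : fiber (k *: x) z a = k *: fiber x z a.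
Proof. by apply/matrixP => p q; rewrite !mxE ffunE. Qed.

Lemma fiber_star x z a u w :
  dotmx (u *m fiber (astar x) z a) w = dotmx u (w *m fiber x z a).
Proof.
rewrite !dotmx_sum; under eq_bigr do rewrite mxE mulr_suml.
under [RHS]eq_bigr do rewrite mxE rmorph_sum mulr_sumr.
rewrite exchange_big; apply: eq_bigr => p _; apply: eq_bigr => q _.
rewrite !mxE [astar x _]tens_starE rmorphM -!mulrA; congr (_ * _).
exact: mulrC.
Qed.

(** The supremum of this set is the C*-norm of [B (x) C(T)]: the largest operator norm of a fibre,
    over all points and blocks. Fibres act on row vectors from the right, and the set consists of
    reals so that [sup] applies. *)
Definition fiber_norms x : set R := [set s | exists z a (u : 'rV[C]_(N a)),
  vnorm u <= 1 /\ s%:C = vnorm (u *m fiber x z a)].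

Definition tnorm x : C := (sup (fiber_norms x))%:C.

(** The dimension of [B], used as the constant that bounds the operator norm by the largest
    entry. *)
Definition tdim : C := (\sum_a (N a * N a))%:R.

Lemma vnorm_fiber_crude x (K : C) : 0 <= K -> (forall i z, `|x i z| <= K) ->
  forall z a u, vnorm (u *m fiber x z a) <= tdim * K * vnorm u.
Proof.
move=> K0 xK z a u; apply: (@le_trans _ _ ((N a * N a)%:R * K * vnorm u)).
  by apply: vnorm_mulmx => // p q; rewrite mxE; exact: xK.
rewrite ler_wpM2r ?vnorm_ge0 // ler_wpM2r // ler_nat.
by rewrite (bigD1 a) //= leq_addr.
Qed.

Lemma tens_bounded x : exists2 K : C, 0 <= K & forall i z, `|x i z| <= K.
Proof.
have ex i : exists K : C, 0 <= K /\ forall z, `|x i z| <= K.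
  by have [K K0 xK] := Ccircle_bounded (x i); exists K.
have [K hK] := choice ex.
exists (\sum_i K i) => [|i z]; first by apply: sumr_ge0 => i _; case: (hK i).
rewrite (bigD1 i) //= (le_trans ((hK i).2 z)) // lerDl sumr_ge0 // => j _.
by case: (hK j).
Qed.

Lemma tnorm_lub x (K : C) : 0 <= K ->
  (forall z a u, vnorm u <= 1 -> vnorm (u *m fiber x z a) <= K) -> tnorm x <= K.
Proof.
move=> K0 xK; rewrite -(RRe_real (ger0_real K0)) lecR.
have Kub : ubound (fiber_norms x) (complex.Re K).
  move=> s [z [a [u [u1 su]]]]; rewrite -lecR su (RRe_real (ger0_real K0)).
  exact: xK.
have [->|/set0P ne] := eqVneq (fiber_norms x) set0.
  by rewrite sup0 -ler0c (RRe_real (ger0_real K0)).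
exact: ge_sup.
Qed.

Lemma fiber_norms_ub x : has_ubound (fiber_norms x).
Proof.
have [K K0 xK] := tens_bounded x.
exists (complex.Re (tdim * K)) => s [z [b [u [u1 sE]]]].
rewrite -lecR sE RRe_real ?ger0_real ?mulr_ge0 ?ler0n //.
apply: le_trans (vnorm_fiber_crude K0 xK z u) _.
by rewrite ler_piMr // mulr_ge0 ?ler0n.
Qed.

Lemma tnorm_ub x z a (u : 'rV[C]_(N a)) :
  vnorm u <= 1 -> vnorm (u *m fiber x z a) <= tnorm x.
Proof.
move=> u1; have uR := RRe_real (ger0_real (vnorm_ge0 (u *m fiber x z a))).
by rewrite -uR lecR; apply: (ub_le_sup (fiber_norms_ub x)); exists z, a, u.
Qed.

Lemma tnorm_ge0 x : 0 <= tnorm x.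
Proof.
rewrite ler0c; have [->|/set0P[s sx]] := eqVneq (fiber_norms x) set0;
  first by rewrite sup0.
have [z [a [u [_ sE]]]] := sx.
by apply: le_trans (ub_le_sup (fiber_norms_ub x) sx);
  rewrite -ler0c sE vnorm_ge0.
Qed.

Local Opaque tnorm.

Lemma vnorm_fiber x z a u : vnorm (u *m fiber x z a) <= tnorm x * vnorm u.
Proof.
have [->|u0] := eqVneq u 0.
  by rewrite mul0mx (eqP (etrans (vnorm_eq0 0) (eqxx _))) mulr0.
have v0 : 0 < vnorm u by rewrite lt_neqAle vnorm_ge0 eq_sym vnorm_eq0 u0.
have scale (r s t : C) :
    0 < r -> (r^-1 * r <= 1 -> r^-1 * s <= t) -> s <= t * r.
  by move=> r0; rewrite mulVf ?gt_eqF // ler_pdivrMl // mulrC => /(_ (lexx _)).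
apply: scale v0 _; have := @tnorm_ub x z a ((vnorm u)^-1 *: u).
by rewrite vnormZ -scalemxAl vnormZ ger0_norm ?invr_ge0 ?vnorm_ge0.
Qed.

Lemma tnorm_le x (K : C) : 0 <= K ->
  (forall z a u, vnorm (u *m fiber x z a) <= K * vnorm u) -> tnorm x <= K.
Proof.
move=> K0 xK; apply: tnorm_lub => // z a u u1.
by rewrite (le_trans (xK z a u)) // ler_piMr.
Qed.

Lemma tnorm_entry x i z : `|x i z| <= tnorm x.
Proof.
case: i => a [p q]; rewrite -[existT _ _ _]/(mi p q).
have -> : x (mi p q) z = ((delta_mx 0 p : 'rV_(N a)) *m fiber x z a) 0 q.
  by rewrite -rowE !mxE.
rewrite (le_trans (vnorm_coord _ _)) // (le_trans (vnorm_fiber _ _ _)) //.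
by rewrite vnorm_delta mulr1.
Qed.

Lemma tnorm_crude x (K : C) : 0 <= K -> (forall i z, `|x i z| <= K) ->
  tnorm x <= tdim * K.
Proof.
by move=> K0 xK; apply: tnorm_le;
  [rewrite mulr_ge0 ?ler0n|exact: vnorm_fiber_crude].
Qed.

Lemma tnormD x y : tnorm (x + y) <= tnorm x + tnorm y.
Proof.
apply: tnorm_le => [|z a u]; first by rewrite addr_ge0 ?tnorm_ge0.
rewrite fiberD mulmxDr mulrDl (le_trans (vnormD _ _)) //.
by rewrite lerD ?vnorm_fiber.
Qed.

Lemma tnormZ k x : tnorm (k *: x) = `|k| * tnorm x.
Proof.
have le h y : tnorm (h *: y) <= `|h| * tnorm y.
  apply: tnorm_le => [|z a u]; first by rewrite mulr_ge0 ?tnorm_ge0.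
  by rewrite fiberZ -scalemxAr vnormZ -mulrA ler_wpM2l ?vnorm_fiber.
have [->|k0] := eqVneq k 0.
  by apply/eqP; rewrite eq_le le normr0 mul0r tnorm_ge0.
apply/eqP; rewrite eq_le le -ler_pdivlMl ?normr_gt0 // -normfV.
by rewrite -{1}[x]scale1r -(mulVf k0) -scalerA le.
Qed.

Lemma tnorm0_eq0 x : tnorm x = 0 -> x = 0.
Proof.
move=> x0; apply/ffunP => i; apply/continuousEP => z; rewrite [in RHS]ffunE.
by apply/eqP; rewrite -[_ == _]normr_le0 -x0 tnorm_entry.
Qed.

Lemma tnormM x y : tnorm (x ** y) <= tnorm x * tnorm y.
Proof.
apply: tnorm_le => [|z a u]; first by rewrite mulr_ge0 ?tnorm_ge0.
rewrite fiberM mulmxA; apply: le_trans (vnorm_fiber _ _ _) _.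
have := vnorm_fiber x z u; have := tnorm_ge0 y.
move: (tnorm x) (tnorm y) (vnorm u) (vnorm _) => r s t w s0 wrt.
by rewrite [r * s]mulrC -mulrA ler_wpM2l.
Qed.

(** With fibres acting on rows, [<u x, u x> = <u x x^*, u>], so Cauchy-Schwarz bounds the norm
    through [x x^*]; the C*-identity for [x^* x] follows once the star is known to be isometric. *)
Lemma tnorm_cstar_ge x : tnorm x ^+ 2 <= tnorm (x ** astar x).
Proof.
have sqE (s t : C) : 0 <= s -> 0 <= t -> (s ^+ 2 <= t) = (s <= sqrtC t).
  by move=> s0 t0; rewrite -{1}(sqrtCK t) ler_pXn2r ?nnegrE ?sqrtC_ge0.
rewrite sqE ?tnorm_ge0 //; apply: tnorm_lub => [|z a u u1].
  by rewrite sqrtC_ge0 tnorm_ge0.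
rewrite -sqE ?tnorm_ge0 ?vnorm_ge0 // vnorm_sqr.
have h : 0 <= dotmx (u *m fiber x z a) (u *m fiber x z a) by exact: dnorm_ge0.
rewrite -(ger0_norm h) -fiber_star -mulmxA -fiberM.
apply: le_trans (dotmx_le _ _) _; apply: le_trans (ler_piMr (vnorm_ge0 _) u1) _.
apply: le_trans (vnorm_fiber _ _ _) _; apply: ler_piMr u1; exact: tnorm_ge0.
Qed.

Lemma tnorm_star x : tnorm (astar x) = tnorm x.
Proof.
have le y : tnorm y <= tnorm (astar y).
  have [->|y0] := eqVneq (tnorm y) 0; first exact: tnorm_ge0.
  have y1 : 0 < tnorm y by rewrite lt_neqAle tnorm_ge0 eq_sym y0.
  by have := le_trans (tnorm_cstar_ge y) (tnormM y (astar y));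
    rewrite expr2 (ler_pM2l y1).
have := le (astar x); rewrite astarK => h.
by apply: le_anti; apply/andP; split; [exact: h|exact: le].
Qed.

Lemma tnorm_cstar x : tnorm (astar x ** x) = tnorm x ^+ 2.
Proof.
have h1 := tnormM (astar x) x; have h2 := tnorm_cstar_ge (astar x).
rewrite tnorm_star -expr2 in h1; rewrite astarK tnorm_star in h2.
by apply: le_anti; apply/andP; split; [exact: h1|exact: h2].
Qed.

HB.instance Definition _ :=
  Lmodule_isNormed.Build C M tnormD tnormZ tnorm0_eq0.

Lemma tnorm_entryB x y i z : `|(x i z : C) - y i z| <= `|x - y|.
Proof. by have := tnorm_entry (x - y) i z; rewrite !ffunE. Qed.

(** Entries converge at each point because the scalars are complete. The approximation by members of
    [F] is uniform in the point, which makes the limits continuous, and [tdim] converts the uniform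
    bound on entries into a norm bound. *)
Lemma tens_complete (F : set_system M) : ProperFilter F -> cauchy F -> cvg F.
Proof.
move=> FF /cauchyP Fc.
have [l lP] : exists l : munits N -> circle -> C^o,
    forall i z, (fun x : M => x i z : C^o) @ F --> l i z.
  have ex i z : exists l : C^o, (fun x : M => x i z : C^o) @ F --> l.
    apply: complex_complete; apply/cauchyP => e e0; have [x Fx] := Fc _ e0.
    exists (x i z); apply: (@filterS _ F _ (ball x e)) Fx => y.
    rewrite -!ball_normE /=; apply: le_lt_trans; exact: tnorm_entryB.
  exists (fun i => projT1 (choice (ex i))) => i z.
  exact: (projT2 (choice (ex i)) z).
have approx e : 0 < e -> exists2 x : M, F (ball x e) &
    forall i z, `|(x i z : C) - l i z| <= e.
  move=> e0; have [x Fx] := Fc _ e0; exists x => // i z.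
  apply/ler_addgt0Pr => r r0.
  have /cvgrPdist_lt /(_ _ r0) Fr := lP i z.
  have [y [xy ly]] := filter_ex (filterI Fx Fr).
  rewrite -(subrKA (y i z : C)) (le_trans (ler_normD _ _)) // lerD //.
    apply: le_trans (tnorm_entryB x y i z) _; apply: ltW.
    by move: xy; rewrite -ball_normE.
  by rewrite distrC ltW.
have lc i : continuous (l i).
  move=> z; apply/(@cvgrPdist_lt C C^o _ _ (nbhs_filter z)) => e e0.
  have e4 : 0 < e / 4 by rewrite divr_gt0.
  have [x _ xl] := approx _ e4.
  have /(@cvgrPdist_lt C C^o _ _ (nbhs_filter z)) /(_ _ e4) :=
    (@cts_fun _ _ (x i) z : x i @ z --> (x i z : C^o)).
  apply: filterS => w zw; rewrite -[_ < _]/(`|(l i z : C) - l i w| < e).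
  have h1 : `|(l i z : C) - x i z| <= e / 4 by rewrite distrC; exact: xl.
  have h2 : `|(x i z : C) - x i w| <= e / 4 by exact: ltW.
  have h3 : `|(x i w : C) - l i w| <= e / 4 by exact: xl.
  rewrite -(subrKA (x i z : C)) -[X in _ + X](subrKA (x i w : C)).
  rewrite (le_lt_trans (ler_normD _ _)) //
    [ltRHS](_ : e = e / 4 + (e / 4 + e / 4) + e / 4).
    rewrite ltr_pwDr ?divr_gt0 // lerD // (le_trans (ler_normD _ _)) //.
    by rewrite lerD.
  by field.
pose L : M := [ffun i => (mkcts (@lc i) : Ccircle C)].
have t0 : 0 < tdim + 1 by rewrite ltr_wpDl ?ler0n.
apply/cvg_ex; exists L; apply/cvgrPdist_lt => e e0.
pose r := e / 2 / (tdim + 1).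
have r0 : 0 < r by rewrite !divr_gt0.
have er : e = tdim * r + r + e / 2.
  rewrite {1}(splitr e); congr (_ + _).
  by rewrite -[X in _ + X]mul1r -mulrDl [RHS]mulrC divfK // lt0r_neq0.
have [x Fx xl] := approx _ r0.
move: Fx; apply: filterS => y; rewrite -ball_normE /= => xy.
have h : `|L - x| <= tdim * r.
  apply: tnorm_crude => [|i z]; first exact: ltW.
  by have := xl i z; rewrite distrC !ffunE.
rewrite -(subrKA x) er (le_lt_trans (ler_normD _ _)) // -addrA ler_ltD //.
by rewrite (lt_le_trans xy) // lerDl divr_ge0 // ltW.
Qed.

HB.instance Definition _ := Uniform_isComplete.Build M tens_complete.

HB.instance Definition _ := StarAlgebra_isCstar.Build C M tnormM tnorm_cstar.

End MatrixFunctions.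

(** * The edge correspondence *)

Section CorrTheory.
Context (C : numClosedFieldType) (d : nat) (N : 'I_d -> nat) (X : corr C N).
Implicit Types (xi eta : X).

Lemma cinner_suml I (r : seq I) (F : I -> X) eta :
  cinner (\sum_(i <- r) F i) eta = \sum_(i <- r) cinner (F i) eta.
Proof.
rewrite -cinner_sym (lin_sum (cinner_linear eta)) astar_sum.
by apply: eq_bigr => i _; rewrite cinner_sym.
Qed.

Lemma cinner_sumr I (r : seq I) (F : I -> X) xi :
  cinner xi (\sum_(i <- r) F i) = \sum_(i <- r) cinner xi (F i).
Proof. exact: lin_sum (cinner_linear xi) _ _ _ _. Qed.

Lemma cinnerZl k xi eta : cinner (k *: xi) eta = k^* *: cinner xi eta.
Proof. by rewrite -cinner_sym (linZ (cinner_linear eta)) astarZ cinner_sym. Qed.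

End CorrTheory.

Section MatrixUnits.
Context (C : numClosedFieldType) (d : nat) (N : 'I_d -> nat).
Local Notation B := (tens N C^o).

Lemma sum_munits (V : nmodType) (F : munits N -> V) :
  \sum_i F i = \sum_a \sum_p \sum_q F (@mi _ N a p q).
Proof.
rewrite (eq_bigr (fun i => F (mi (tagged i).1 (tagged i).2)));
  last by case=> a [p q].
under [RHS]eq_bigr do rewrite pair_bigA /=.
by rewrite sig_big_dep /=.
Qed.

Lemma munit_mi a (p q r s : 'I_(N a)) :
  munit C (mi r s) (mi p q) = ((p == r) && (q == s))%:R.
Proof. by rewrite munitE eq_Tagged xpair_eqE. Qed.

Lemma munit_block a b (p q : 'I_(N b)) (r s : 'I_(N a)) : b != a ->
  munit C (mi r s) (mi p q) = 0.
Proof.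
move=> ba; rewrite munitE; case: eqP => // -[ab _].
by rewrite ab eqxx in ba.
Qed.

Lemma munit_mul a (r s : 'I_(N a)) (x : B) :
  munit C (mi r s) ** x = \sum_q (x (mi s q) : C) *: munit C (mi r q).
Proof.
apply: tensP => b p q; rewrite [LHS]tens_mulE sum_ffunE.
have [ab|ba] := eqVneq b a; last first.
  rewrite big1 => [|t _]; last by rewrite munit_block // amul0l.
  by rewrite big1 // => t _; rewrite ffunE munit_block // scaler0.
move: p q; rewrite ab => p q.
rewrite (bigD1 s) //= big1 ?addr0; last first.
  by move=> t ts; rewrite munit_mi (negPf ts) andbF; exact: mul0r.
rewrite (bigD1 q) //= big1 ?addr0; last first.
  by move=> t tq; rewrite ffunE munit_mi [q == t]eq_sym (negPf tq) andbF
    scaler0.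
by rewrite munit_mi [RHS]ffunE munit_mi !eqxx !andbT; exact: mulrC.
Qed.

Lemma munit_mul_munit a (r s t q : 'I_(N a)) :
  munit C (mi r s) ** munit C (mi t q) = (s == t)%:R *: munit C (mi r q).
Proof.
rewrite munit_mul (bigD1 q) //= big1 ?addr0; last first.
  by move=> w wq; rewrite munit_mi (negPf wq) andbF scale0r.
by rewrite munit_mi eqxx andbT.
Qed.

Lemma tens_scaleE (V : lmodType C) k (w : tens N V) i : (k *: w) i = k *: w i.
Proof. exact: ffunE. Qed.

Lemma tens_sum_etens (V : lmodType C) (w : munits N -> V) :
  \sum_i etens (munit C i) (w i) = [ffun i => w i] :> tens N V.
Proof.
by rewrite [RHS]tens_sum; apply: eq_bigr => i _; rewrite ffunE.
Qed.

Lemma unitB_sum : unitB = \sum_a \sum_(r < N a) munit C (mi r r) :> B.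
Proof.
rewrite (munit_sum unitB) sum_munits; apply: eq_bigr => a _;
  apply: eq_bigr => p _.
rewrite (bigD1 p) //= big1 ?addr0; last first.
  by move=> q qp; rewrite ffunE /= eq_sym (negPf qp) scale0r.
by rewrite ffunE eqxx scale1r.
Qed.

(** Matrix algebras are simple: if the entry [(p, q)] of [T] in a block is [c <> 0], then the unit
    of that block is the sum over [r] of [e_rp T (c^-1 e_qr)]. *)
Lemma unitB_generated (T : B) : (forall a, block a T != 0) ->
  exists s : seq (B * B), \sum_(k <- s) k.1 ** T ** k.2 = unitB.
Proof.
move=> T0; have nz a : exists pq : 'I_(N a) * 'I_(N a), T (mi pq.1 pq.2) != 0.
  apply: contrapT => nex; move: (T0 a) => /negP; apply;
    apply/eqP/matrixP => p q.
  rewrite !mxE; apply/eqP; apply: contrapT => /negP pq; apply: nex.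
  by exists (p, q).
pose pq a := projT1 (cid (nz a)).
have pqP a : T (mi (pq a).1 (pq a).2) != 0 by exact: projT2 (cid (nz a)).
pose s : seq (B * B) := flatten [seq [seq (munit C (mi r (pq a).1),
  (T (mi (pq a).1 (pq a).2) : C)^-1 *: munit C (mi (pq a).2 r)) | r <- enum
    'I_(N a)] | a <- enum 'I_d].
exists s; rewrite /s big_flatten big_map big_enum /= unitB_sum.
apply: eq_bigr => a _; rewrite big_map big_enum /=; apply: eq_bigr => r _.
rewrite munit_mul amul_suml (bigD1 (pq a).2) //= big1 ?addr0; last first.
  by move=> q qp; rewrite amulZl amulZr munit_mul_munit (negPf qp) scale0r
    !scaler0.
by rewrite amulZl amulZr munit_mul_munit eqxx scale1r scalerA mulfV ?scale1r.
Qed.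

End MatrixUnits.

Section Comultiplication.
Context (C : numClosedFieldType) (d : nat) (N : 'I_d -> nat) (Q : fqspace C N).
Local Notation B := (tens N C^o).
Local Notation e i := (munit C i).
Local Notation z := (fq_mstar Q unitB).

Lemma amul_linear (x : B) : linear (fun y : B => x ** y).
Proof. by move=> k u v; rewrite amulDr amulZr. Qed.

Lemma amulr_linear (y : B) : linear (fun x : B => x ** y).
Proof. by move=> k u v; rewrite amulDl amulZl. Qed.

(* (psi(y . -) (x) id) m^*(1) = y *)
Lemma mstar1_slice (y : B) : \sum_i (Q (y ** e i) : C) *: z i = y.
Proof.
set S := \sum_i _.
(* This is the defining relation of [m^*] tested on [y^* (x) w] against [1]; faithfulness of [psi]
   then removes [w]. *)
have key w : Q (astar w ** S) = Q (astar w ** y).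
  have := fq_mstarP Q (etens (astar y) w) unitB.
  rewrite /mulB tlift_etens; [|exact: amulr_linear|exact: amul_linear].
  rewrite amulB1 astarM astarK => ->; rewrite /tsesqui exchange_big /=.
  rewrite /S amul_sumr linear_sum; apply: eq_bigr => j _ /=.
  rewrite amulZr linearZ /=.
  rewrite -[y in LHS]astarK [in LHS](munit_sum (astar y)) astar_sum amul_suml
    linear_sum scaler_suml.
  apply: eq_bigr => i _; rewrite [etens _ _ _]ffunE !astarZ !amulZl !linearZ /=.
  by rewrite /GRing.scale /= mulrA [X in X * _]mulrC.
apply/eqP; rewrite -subr_eq0; apply/eqP; apply: (fq_psi_faithful (f := Q)).
by rewrite amulBr linearB /= !key subrr.
Qed.

(** The slice formula at [y = e_rs], read off at the entry [(t, q)]. It identifies the coefficients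
    of [m^* 1] with those of the inverse density, and its case [q = s] proves that the density is
    invertible. *)
Lemma density_mstar1 a (s q : 'I_(N a)) :
  (\matrix_(t, k) (z (mi s k) (mi t q) : C)) *m density Q a = (q == s)%:R%:M.
Proof.
apply/matrixP => t r; rewrite !mxE.
have := congr1 (fun f : B => f (mi t q)) (mstar1_slice (e (mi r s))).
rewrite munit_mi.
have -> : \sum_i (Q (e (mi r s) ** e i) : C) *: z i =
    \sum_k (Q (e (mi r k)) : C) *: z (mi s k).
  under eq_bigr do rewrite munit_mul linear_sum scaler_suml.
  rewrite exchange_big; apply: eq_bigr => k _ /=.
  rewrite -[in RHS](sum_munit z (mi s k)) scaler_sumr; apply: eq_bigr => i _.
  by rewrite linearZ scalerA mulrC.
rewrite sum_ffunE; under eq_bigr do rewrite ffunE.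
move=> h; transitivity (((t == r) && (q == s))%:R : C); last by case: (t == r);
  case: (q == s).
by rewrite -h; apply: eq_bigr => k _; rewrite !mxE; exact: mulrC.
Qed.

(** The entry [(p, q)] of the left side is the trace of [c] against the coefficients of [m^* 1],
    which form the inverse density if [p = q] and vanish otherwise. *)
Lemma mstar1_contract (c : B) :
  (forall a, \tr (invmx (density Q a) *m block a c) = fq_delta Q ^+ 2) ->
  \sum_i e i ** c ** z i = fq_delta Q ^+ 2 *: unitB.
Proof.
move=> trc; apply: tensP => a p q; rewrite sum_ffunE.
pose Z := \matrix_(t, k) (z (mi p k) (mi t q) : C).
have zZ t k : (z (mi p k) (mi t q) : C) = Z t k by rewrite mxE.
transitivity (\tr (Z *m block a c)).
  rewrite /mxtrace; under [RHS]eq_bigr do rewrite mxE.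
  transitivity (\sum_i \sum_t \sum_k (e i (mi p k) : C) * (c (mi k t) : C) * (z
    i (mi t q) : C)).
    apply: eq_bigr => i _; rewrite [LHS]tens_mulE; apply: eq_bigr => t _.
    by rewrite [(_ ** c) _]tens_mulE; exact: mulr_suml.
  rewrite exchange_big /=; apply: eq_bigr => t _; rewrite exchange_big /=.
  apply: eq_bigr => k _; rewrite !mxE -(sum_munit z (mi p k)) sum_ffunE
    mulr_suml.
  by apply: eq_bigr => i _; rewrite tens_scaleE; exact: mulrAC.
have pU : density Q a \in unitmx by have := density_mstar1 p p;
  rewrite eqxx => /mulmx1_unit[].
have -> : Z = (q == p)%:R%:M *m invmx (density Q a).
  by rewrite -(density_mstar1 p q) mulmxK.
rewrite mul_scalar_mx -scalemxAl mxtraceZ trc ffunE [unitB _]ffunE /= eq_sym.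
exact: mulrC.
Qed.

End Comultiplication.

Section EdgeGenerator.
Context (C : numClosedFieldType) (d : nat) (N : 'I_d -> nat) (G : qgraph C N).
Context (T : tens N C^o) (T_rank_one : rank_one G T).
Local Notation B := (tens N C^o).
Local Notation e i := (munit C i).
Local Notation z := (fq_mstar G unitB).
Local Notation delta := (fq_delta G).

Lemma delta_conj : delta^* = delta.
Proof. by apply: conj_Creal; exact: gtr0_real (fq_delta_gt0 G). Qed.

Definition edge_elt (x y : B) : BpsiB G := lact x (ract (qg_eps G : BpsiB G) y).

Lemma edge_eltE x y : edge_elt x y =
  \sum_i (etens (x ** e i) ((delta ^+ 2)^-1 *: (T ** z i ** astar T **
    y)) : BpsiB G).
Proof.
case: T_rank_one => _ TE.
rewrite /edge_elt /= tens_ractE /tens_lact /tmap /tlift; apply: eq_bigr => i _.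
congr (etens _ _); rewrite ffunE /qg_eps /tmap /tlift tens_sum_etens !ffunE TE.
by rewrite amulZl.
Qed.

Lemma inner_etens_edge (a b x y : B) :
  cinner (etens a b : BpsiB G) (edge_elt x y) =
  (delta ^+ 2)^-1 *: (astar b ** T ** (astar a ** x) ** astar T ** y).
Proof.
rewrite edge_eltE cinner_sumr; under eq_bigr do rewrite /= tens_inner_etens.
rewrite -[astar a ** x in RHS](mstar1_slice G) amul_sumr !amul_suml scaler_sumr.
apply: eq_bigr => i _; rewrite !amulZr !amulZl scalerA [RHS]scalerA mulrC
  !amulA.
by [].
Qed.

(** The slice formula collapses the right vector. Expanding the left one leaves
    [\sum_i z_i^* (T^* T) e_i^*] in the middle, the adjoint of [\sum_i e_i (T^* T) z_i], which the
    trace condition evaluates to [delta^2]; this cancels one of the two factors [delta^-2]. *)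
Lemma inner_edge (x y x' y' : B) :
  cinner (edge_elt x y) (edge_elt x' y') =
  (delta ^+ 2)^-1 *: (astar (x ** astar T ** y) ** (x' ** astar T ** y')).
Proof.
have [trT TE] := T_rank_one.
rewrite edge_eltE cinner_suml.
under eq_bigr do rewrite inner_etens_edge.
have d0 : delta ^+ 2 != 0 by rewrite expf_neq0 // lt0r_neq0 // fq_delta_gt0.
have Sz : \sum_i astar (z i) ** (astar T ** T) ** astar (e i) = delta ^+ 2
  *: unitB.
  have := congr1 astar (mstar1_contract trT); rewrite astar_sum astarZ.
  rewrite rmorphXn /= delta_conj.
  have -> : astar unitB = unitB :> B.
    by rewrite -[LHS]amul1B -[X in X ** _]astarK -astarM amul1B astarK.
  by move=> <-; apply: eq_bigr => i _; rewrite !astarM astarK !amulA.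
transitivity ((delta ^+ 2)^-1 *: ((delta ^+ 2)^-1 *: (astar y ** T **
    (\sum_i astar (z i) ** (astar T ** T) ** astar (e i)) **
    (astar x ** x' ** astar T ** y')))).
  rewrite amul_sumr !amul_suml !scaler_sumr; apply: eq_bigr => i _.
  rewrite !astarM !astarZ fmorphV rmorphXn /= delta_conj !amulZl !astarM
    !astarK.
  by rewrite !amulA.
rewrite Sz amulZr amulZl amulB1 scalerA scalerA -mulrA mulVf // mulr1.
by rewrite !astarM astarK !amulA.
Qed.

(** The map [cinner u] identifies the edge correspondence with [B]: the clauses say that it sends
    [u] to [1], respects the left action and preserves inner products. Nothing else about the
    quantum graph is used afterwards. *)
Lemma edge_central_unit : (forall a, block a T != 0) ->
  exists u : edge_corr G, [/\ cinner u u = unitB,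
    forall b xi, cinner u (lact b xi) = b ** cinner u xi &
    forall xi eta, cinner xi eta = astar (cinner u xi) ** cinner u eta].
Proof.
move=> T0; have [s sT] : exists s : seq (B * B),
  \sum_(k <- s) k.1 ** astar T ** k.2 = unitB.
  apply: unitB_generated => a; apply: contra (T0 a) => /eqP Ta.
  apply/eqP/matrixP => p q; have := congr1 (fun m : 'M[C]_(N a) => m q p) Ta.
  by rewrite !mxE [astar T _]tens_starE => /eqP; rewrite conjC_eq0 => /eqP.
have d0 : delta != 0 by rewrite lt0r_neq0 // fq_delta_gt0.
(* A preimage of [1] under [x eps y |-> delta^-1 x T^* y], hence the factor [delta]. *)
pose u0 : BpsiB G := \sum_(k <- s) delta *: edge_elt k.1 k.2.
have u0E : u0 \in edge_space G.
  by apply: rpred_sum => k _; apply: rpredZ; exact: mem_edge_space.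
have u0g x y : cinner u0 (edge_elt x y) = delta^-1 *: (x ** astar T ** y).
  rewrite cinner_suml; under eq_bigr do rewrite cinnerZl delta_conj inner_edge
    scalerA.
  rewrite -scaler_sumr -amul_suml -astar_sum sT.
  have -> : astar unitB = unitB :> B.
    by rewrite -[LHS]amul1B -[X in X ** _]astarK -astarM amul1B astarK.
  by rewrite amul1B expr2 invfM mulrA mulfV // mul1r.
have span (xi : edge_corr G) : exists s : seq (B * B),
    vsval xi = \sum_(k <- s) edge_elt k.1 k.2.
  by apply/edge_spaceP; exact: subvsP.
exists (Subvs u0E); split=> [|b xi|xi eta].
- rewrite -[LHS]/(cinner u0 u0) {2}/u0 cinner_sumr -[RHS]sT;
  apply: eq_bigr => k _.
  by rewrite (linZ (cinner_linear _)) u0g scalerA mulfV ?scale1r.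
- rewrite -[LHS]/(cinner u0 (lact b (vsval xi : BpsiB G))).
  rewrite -[cinner _ xi]/(cinner u0 (vsval xi : BpsiB G)).
  have [r ->] := span xi; rewrite (lin_sum (lact_linearr b)) !cinner_sumr
    amul_sumr.
  apply: eq_bigr => k _.
  by rewrite -[lact b _]lactM -/(edge_elt _ _) !u0g amulZr !amulA.
rewrite -[LHS]/(cinner (vsval xi : BpsiB G) (vsval eta)).
rewrite -[cinner _ xi]/(cinner u0 (vsval xi : BpsiB G)).
rewrite -[cinner _ eta]/(cinner u0 (vsval eta : BpsiB G)).
have [r ->] := span xi; have [t ->] := span eta.
rewrite cinner_suml !cinner_sumr astar_sum amul_suml; apply: eq_bigr => k _.
rewrite cinner_sumr amul_sumr; apply: eq_bigr => l _.
rewrite inner_edge !u0g astarZ amulZl amulZr scalerA fmorphV /= delta_conj.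
by rewrite expr2 invfM.
Qed.

End EdgeGenerator.

(** * Correspondences with a central unitary generator *)

Section ElementaryTensors.
Context (C : numClosedFieldType) (d : nat) (N : 'I_d -> nat) (D : starAlgType
  C).
Local Notation B := (tens N C^o).
Implicit Types (b c : B) (f g : D).

Lemma tens_amulE (x y : tens N D) a (p q : 'I_(N a)) :
  (x ** y) (mi p q) = \sum_r x (mi p r) ** y (mi r q).
Proof. exact: tens_mulE. Qed.

Lemma tens_astarE (x : tens N D) a (p q : 'I_(N a)) :
  astar x (mi p q) = astar (x (mi q p)).
Proof. exact: tens_starE. Qed.

Lemma etens_mul b c f g : etens b f ** etens c g = etens (b ** c) (f ** g).
Proof.
apply: tensP => a p q; rewrite [LHS]tens_mulE [RHS]ffunE [(b ** c) _]tens_mulE.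
rewrite scaler_suml; apply: eq_bigr => r _;
  rewrite !ffunE amulZl amulZr scalerA.
by [].
Qed.

Lemma etens_star b f : astar (etens b f) = etens (astar b) (astar f).
Proof.
by apply: tensP => a p q; rewrite [LHS]tens_starE !ffunE astarZ.
Qed.

Lemma etens_linl f : linear (fun b => etens b f).
Proof. by move=> k x y; apply/ffunP => i; rewrite !ffunE scalerDl scalerA. Qed.

Lemma etens_linr b : linear (etens b : D -> tens N D).
Proof.
by move=> k x y; apply/ffunP => i; rewrite !ffunE scalerDr !scalerA mulrC.
Qed.

Lemma star_unitB : astar unitB = unitB :> B.
Proof. by rewrite -[LHS]amul1B -[X in X ** _]astarK -astarM amul1B astarK. Qed.

Lemma etens_unit_hom : star_hom (fun f => etens unitB f : tens N D).
Proof.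
split=> [|f g|f]; first exact: etens_linr.
  by rewrite etens_mul amul1B.
by rewrite etens_star star_unitB.
Qed.

Lemma munit_star a (p q : 'I_(N a)) : astar (munit C (mi p q)) = munit C (mi q
  p).
Proof.
pose sw (i : munits N) : munits N := mi (tagged i).2 (tagged i).1.
have swK : involutive sw by case=> b [].
apply: tensP => b r s.
transitivity ((munit C (mi p q) (mi s r) : C)^*); first exact: tens_starE.
rewrite [RHS]munitE -(inj_eq (inv_inj swK)).
exact: (etrans (congr1 (fun k : C =>
  k^*) (munitE C (mi p q) (mi s r))) (conjC_nat C _)).
Qed.

Lemma munit_compress a (p q r : 'I_(N a)) (x : B) :
  munit C (mi r p) ** x ** munit C (mi q r) = (x (mi p q) : C) *: munit C (mi r
    r).
Proof.
rewrite munit_mul amul_suml (bigD1 q) //= big1 ?addr0 => [|s sq].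
  by rewrite amulZl munit_mul_munit eqxx scale1r.
by rewrite amulZl munit_mul_munit (negPf sq) scale0r scaler0.
Qed.

(** Moves an arbitrary entry into a diagonal corner by multiplying with matrix units, so that norm
    estimates need only be made there. *)
Lemma etens_compress a (p q r : 'I_(N a)) (one : D) (x : tens N D) :
  (forall f, one ** f = f) -> (forall f, f ** one = f) ->
  etens (munit C (mi r p)) one ** x ** etens (munit C (mi q r)) one =
  etens (munit C (mi r r)) (x (mi p q)).
Proof.
move=> one_l one_r; rewrite [x in LHS]tens_sum amul_sumr amul_suml.
rewrite -[in RHS](sum_munit x (mi p q)).
rewrite [RHS](lin_sum (etens_linr (munit C (mi r r)))).
apply: eq_bigr => i _; rewrite !etens_mul one_l one_r munit_compress.
by rewrite (linZ (etens_linl _)) (linZ (etens_linr _)).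
Qed.

End ElementaryTensors.

Section CircleAlgebra.
Variable R : realType.
Local Notation C := R[i].
Local Notation Ccircle := (Ccircle C).
Local Notation circle := (@Defs.circle C).

Lemma mul1T (f : Ccircle) : oneT R ** f = f.
Proof. by apply/continuousEP => z; exact: mul1r. Qed.

Lemma mulT1 (f : Ccircle) : f ** oneT R = f.
Proof. by apply/continuousEP => z; exact: mulr1. Qed.

Lemma absT_continuous (f : Ccircle) : continuous (fun z : circle =>
  (`|f z : C| : C^o)).
Proof.
move=> z; apply/(@cvgrPdist_lt C C^o _ _ (nbhs_filter z)) => e e0.
have /(@cvgrPdist_lt C C^o _ _ (nbhs_filter z)) /(_ _ e0) :=
  (@cts_fun _ _ f z : f @ z --> (f z : C^o)).
apply: filterS => w; apply: le_lt_trans; exact: ler_dist_dist.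
Qed.

Definition absT (f : Ccircle) : Ccircle := mkcts (@absT_continuous f).

Lemma invT_continuous (f : Ccircle) : (forall z, f z != 0) ->
  continuous (fun z : circle => ((f z : C)^-1 : C^o)).
Proof.
move=> f0 z.
exact: (@cvgV C _ _ (nbhs_filter z) f _ (f0 z) (@cts_fun _ _ f z : f @ z --> (f
  z : C^o))).
Qed.

Definition invT (f : Ccircle) (f0 : forall z, f z != 0) : Ccircle :=
  mkcts (@invT_continuous f f0).

End CircleAlgebra.

Section CentralGenerator.
Context (R : realType) (d : nat) (N : 'I_d -> nat).
Local Notation C := R[i].
Local Notation B := (tens N C^o).
Local Notation M := (tens N (Ccircle C)).
Context (X : corr C N) (u : X).
Hypothesis u_unit : cinner u u = unitB.
Hypothesis u_central : forall b xi, cinner u (lact b xi) = b ** cinner u xi.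
Hypothesis u_inner : forall xi eta,
  cinner xi eta = astar (cinner u xi) ** cinner u eta.
Local Notation phi := (cinner u).

Lemma central_inj xi eta : phi xi = phi eta -> xi = eta.
Proof.
move=> h; apply/eqP; rewrite -subr_eq0; apply/eqP/cinner_def; rewrite u_inner.
have -> : phi (xi - eta) = 0.
  by rewrite -scaleN1r (linD (cinner_linear u)) (linZ (cinner_linear u)) h
    scaleN1r subrr.
exact: amul0r.
Qed.

Lemma phi_lact b : phi (lact b u) = b.
Proof. by rewrite u_central u_unit amulB1. Qed.

Lemma lact_phi xi : lact (phi xi) u = xi.
Proof. by apply: central_inj; rewrite phi_lact. Qed.

Definition model_pi (b : B) : M := etens b (oneT R).
Definition model_t (xi : X) : M := etens (phi xi) (zeta R).

Lemma zetaVzeta : astar (zeta R) ** zeta R = oneT R.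
Proof. by case: (zeta_unitary R). Qed.

Lemma zetazetaV : zeta R ** astar (zeta R) = oneT R.
Proof. by case: (zeta_unitary R). Qed.

Lemma star_oneT : astar (oneT R) = oneT R.
Proof. by case: (zeta_unitary R). Qed.

Lemma etens_eval b (f : Ccircle C) i z : (etens b f : M) i z = (b i : C) * (f
  z : C).
Proof. by rewrite ffunE. Qed.

Lemma model_pi_hom : star_hom model_pi.
Proof.
split=> [|b c|b]; first exact: etens_linl.
  by rewrite /model_pi etens_mul mul1T.
by rewrite /model_pi etens_star star_oneT.
Qed.

Lemma theta_u : theta u u = lact unitB.
Proof.
apply/funext => xi; apply: central_inj; rewrite u_central amul1B.
by rewrite /theta cinner_ract u_unit amul1B.
Qed.

Lemma compact_ract (k : X -> X) : compact_op k ->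
  forall xi y, k (ract xi y) = ract (k xi) y.
Proof.
move=> [s kE] xi y; rewrite !kE (lin_sum (ract_linearl y)).
by apply: eq_bigr => p _; rewrite /theta cinner_ract ractM.
Qed.

(** Compact operators are right linear and [xi = u . phi xi], so [k] becomes left multiplication by
    [phi (k u)]. *)
Lemma phi_compact (k : X -> X) xi : compact_op k -> phi (k xi) = phi (k u) **
  phi xi.
Proof.
move=> kc; rewrite -cinner_ract -compact_ract //; congr (phi (k _)).
by apply: central_inj; rewrite cinner_ract u_unit amul1B.
Qed.

Lemma model_covariant : covariant model_pi model_t.
Proof.
split.
  split=> [||b xi|xi eta]; first exact: model_pi_hom.
  - by move=> k xi eta; rewrite /model_t cinner_linear etens_linl.
  - by rewrite /model_pi /model_t etens_mul mul1T u_central.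
  - by rewrite /model_pi /model_t etens_star etens_mul zetaVzeta -u_inner.
(* Under [phi] a compact operator is the left multiplication by [phi (k u)], which dictates this
   choice of the induced homomorphism. *)
exists (fun k => model_pi (phi (k u))); split; last first.
  by move=> b _; rewrite phi_lact.
have lin := star_hom_linear model_pi_hom.
split=> [c k l _ _|k l kc lc|k l _ _ kl|xi eta].
- by rewrite cinner_linear lin.
- by rewrite /= phi_compact // (star_homM model_pi_hom).
- rewrite -(star_hom_star model_pi_hom); congr model_pi.
  by rewrite cinner_sym kl.
rewrite /model_pi /model_t etens_star etens_mul zetazetaV; congr (etens _ _).
by rewrite /theta cinner_ract cinner_sym.
Qed.

Section Universal.
Context (D : cstarAlgType C) (pi : B -> D) (t : X -> D).
Hypothesis cov : covariant pi t.

Let rep : representation pi t. Proof. by case: cov. Qed.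
Let pi_hom : star_hom pi. Proof. by case: rep. Qed.

Lemma covariant_unitary : corner_unitary (pi unitB) (t u).
Proof.
have [_ _ tl ti] := rep.
split; first by rewrite -(star_homM pi_hom) amul1B.
- by rewrite -(star_hom_star pi_hom) star_unitB.
- by rewrite ti u_unit.
(* Covariance enters here, at [1]: the left action of [1] is the compact operator [theta u u], and
   [1] lies in the Katsura ideal because the left action is faithful. *)
- have [_ [psit [[_ _ _ psi_theta] psi_lact]]] := cov.
  rewrite -psi_theta theta_u -psi_lact //; split.
    by exists [:: (u, u)] => xi; rewrite big_seq1 theta_u.
  by move=> y y0; rewrite -[y]phi_lact y0 (lin0 (cinner_linear u)) amul0r.
- by rewrite tl; congr t; apply: central_inj; rewrite u_central amul1B.
Qed.

Let uv := covariant_unitary.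

Lemma pi_unit b : pi b ** pi unitB = pi b.
Proof. by rewrite -(star_homM pi_hom) amulB1. Qed.

(** From [<u, c u> = c] comes [v^* pi(c) v = pi(c)] for [v = t u]. If [x] is the commutator of
    [pi b] and [v], the four terms of [x^* x] all equal [pi(b^* b)] up to sign and cancel; the
    C*-identity then gives [x = 0]. *)
Lemma pi_comm_t b : pi b ** t u = t u ** pi b.
Proof.
have [_ _ tl ti] := rep.
have vpv c : astar (t u) ** (pi c ** t u) = pi c by rewrite tl ti phi_lact.
have vv : astar (t u) ** t u = pi unitB by case: uv.
apply/eqP; rewrite -subr_eq0 -normr_eq0 -sqrf_eq0 -norm_cstar normr_eq0;
  apply/eqP.
rewrite astarB !astarM -!(star_hom_star pi_hom) amulBr !amulBl.
have e1 : astar (t u) ** pi (astar b) ** (pi b ** t u) = pi (astar b ** b).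
  by rewrite -amulA [pi _ ** (_ ** _)]amulA -(star_homM pi_hom) vpv.
have e2 : pi (astar b) ** astar (t u) ** (pi b ** t u) = pi (astar b ** b).
  by rewrite -amulA vpv -(star_homM pi_hom).
have e3 : astar (t u) ** pi (astar b) ** (t u ** pi b) = pi (astar b ** b).
  by rewrite amulA -[astar (t u) ** _ ** _]amulA vpv -(star_homM pi_hom).
have e4 : pi (astar b) ** astar (t u) ** (t u ** pi b) = pi (astar b ** b).
  rewrite amulA -[pi (astar b) ** _ ** _]amulA vv -!(star_homM pi_hom).
  by rewrite amulB1.
by rewrite e1 e2 e3 e4 !subrr.
Qed.

Local Notation L := (fcalc uv).

Lemma pi_comm_fcalc b f : pi b ** L f = L f ** pi b.
Proof.
apply: fcalc_comm.
- by rewrite -!(star_homM pi_hom) amulB1 amul1B.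
- exact: pi_comm_t.
- have := congr1 astar (pi_comm_t (astar b)).
  by rewrite !astarM -(star_hom_star pi_hom) astarK.
Qed.

Definition model_lift : M -> D := tlift (fun b f => pi b ** L f).

Let lift_linl f : linear (fun b => pi b ** L f).
Proof. by move=> k x y; rewrite (star_hom_linear pi_hom) amulDl amulZl. Qed.

Let lift_linr b : linear (fun f => pi b ** L f).
Proof.
by move=> k x y; rewrite (star_hom_linear (fcalc_hom uv)) amulDr amulZr.
Qed.

Lemma model_lift_etens b f : model_lift (etens b f) = pi b ** L f.
Proof. by apply: tlift_etens. Qed.

Lemma model_lift_linear : linear model_lift.
Proof. exact: tlift_linear. Qed.

Lemma model_lift_hom : star_hom model_lift.
Proof.
have lin := model_lift_linear.
split=> // [x y|x].
  rewrite [x]tens_sum [y]tens_sum amul_suml !(lin_sum lin) amul_suml.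
  apply: eq_bigr => i _; rewrite amul_sumr amul_sumr (lin_sum lin).
  apply: eq_bigr => j _; rewrite etens_mul !model_lift_etens.
  rewrite (star_homM pi_hom) (star_homM (fcalc_hom uv)) -!amulA; congr (_ ** _).
  by rewrite [in RHS]amulA -pi_comm_fcalc amulA.
rewrite [x]tens_sum astar_sum !(lin_sum lin) astar_sum; apply: eq_bigr => i _.
rewrite etens_star !model_lift_etens (star_hom_star pi_hom).
by rewrite (star_hom_star (fcalc_hom uv)) astarM -(star_hom_star pi_hom)
  -(star_hom_star (fcalc_hom uv)) pi_comm_fcalc.
Qed.

Lemma model_lift_pi b : model_lift (model_pi b) = pi b.
Proof. by rewrite model_lift_etens fcalc1 pi_unit. Qed.

Lemma model_lift_t xi : model_lift (model_t xi) = t xi.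
Proof.
have [_ _ tl _] := rep.
by rewrite model_lift_etens fcalc_zeta tl lact_phi.
Qed.

Lemma norm_pi_munit a (p q : 'I_(N a)) : `|pi (munit C (mi p q))| <= 1.
Proof.
have pi_munit r s w v : pi (munit C (mi r s)) ** pi (munit C (mi w v)) =
    (s == w)%:R *: pi (munit C (mi r v)) :> D.
  by rewrite -(star_homM pi_hom) munit_mul_munit (star_homZ pi_hom).
rewrite -(@expr_le1 _ 2) // -norm_cstar -(star_hom_star pi_hom) munit_star.
rewrite pi_munit eqxx scale1r; apply: norm_proj.
  by rewrite pi_munit eqxx scale1r.
by rewrite -(star_hom_star pi_hom) munit_star.
Qed.

Lemma model_lift_bounded : exists2 K : C, 0 <= K &
  forall x : M, `|model_lift x| <= K * `|x|.
Proof.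
exists (\sum_i `|pi (munit C i)|) => [|x]; first exact: sumr_ge0.
rewrite {1}(tens_sum x) (lin_sum model_lift_linear) mulr_suml.
apply: le_trans (ler_norm_sum _ _ _) _; apply: ler_sum => i _.
rewrite model_lift_etens; apply: le_trans (norm_amul _ _) _.
apply: ler_wpM2l => //; apply: norm_fcalc => // z; exact: tnorm_entry.
Qed.

Section Corner.
Context (sigma : D -> M) (sigma_hom : star_hom sigma).
Hypothesis sigma_pi : forall b, sigma (pi b) = model_pi b.
Hypothesis sigma_t : forall xi, sigma (t xi) = model_t xi.
Context (a : 'I_d) (p : 'I_(N a)) (w : @Defs.circle C).
Local Notation epp := (munit C (mi p p)).

(** The image in [D] of the copy [e_pp (x) C(T)] of [C(T)]. It is multiplicative because [pi e_pp]
    is a projection that commutes with the functional calculus. *)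
Definition corner_calc (f : Ccircle C) : D := pi epp ** L f.

Local Notation h := corner_calc.

Let epp_mul : epp ** epp = epp.
Proof. by rewrite munit_mul_munit eqxx scale1r. Qed.

Lemma corner_calc_linear : linear h.
Proof. exact: lift_linr. Qed.

Lemma corner_calcM f g : h (f ** g) = h f ** h g.
Proof.
rewrite /h (star_homM (fcalc_hom uv)) -[RHS]amulA [L f ** (_ ** _)]amulA
  -pi_comm_fcalc.
by rewrite -[pi epp ** L f ** L g]amulA [RHS]amulA -(star_homM pi_hom) epp_mul.
Qed.

Lemma corner_calc_star f : h (astar f) = astar (h f).
Proof.
rewrite /h astarM -(star_hom_star pi_hom) munit_star pi_comm_fcalc.
by rewrite (star_hom_star (fcalc_hom uv)).
Qed.

Lemma norm_corner_calc (f : Ccircle C) (K : C) : 0 <= K -> (forall z, `|f z| <=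
  K) -> `|h f| <= K.
Proof.
move=> K0 fK; apply: le_trans (norm_amul _ _) _.
rewrite -[K]mul1r; apply: ler_pM => //; first exact: norm_pi_munit.
exact: norm_fcalc.
Qed.

(** A character of [C(T)] that sends [zeta] to [w]. As [sigma] is not assumed continuous, its value
    at [f] is not read off from Laurent approximations of [f]. *)
Definition corner_char (f : Ccircle C) : C := sigma (h f) (mi p p) w.

Local Notation ch := corner_char.

Lemma corner_char_linear k f g : ch (k *: f + g) = k * ch f + ch g.
Proof.
by rewrite /ch corner_calc_linear (star_hom_linear sigma_hom) !ffunE.
Qed.

Lemma corner_charM f g : ch (f ** g) = ch f * ch g.
Proof.
rewrite /ch corner_calcM (star_homM sigma_hom) tens_amulE eval_sum.
rewrite (bigD1 p) //= big1 ?addr0 // => r rp.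
have hE : h f = h f ** pi epp.
  by rewrite /h -amulA -pi_comm_fcalc amulA -(star_homM pi_hom) epp_mul.
suff -> : sigma (h f) (mi p r) = 0 by exact: mul0r.
rewrite hE (star_homM sigma_hom) sigma_pi tens_amulE big1 // => s _.
by rewrite ffunE munit_mi (negPf rp) andbF scale0r amul0r.
Qed.

Lemma corner_char1 : ch (oneT R) = 1.
Proof.
rewrite /ch /h fcalc1 pi_unit sigma_pi etens_eval munit_mi !eqxx.
exact: mul1r.
Qed.

Lemma corner_char_zeta : ch (zeta R) = cval w.
Proof.
have [_ _ tl _] := rep.
rewrite /ch /h fcalc_zeta tl sigma_t /model_t phi_lact etens_eval munit_mi
  !eqxx.
exact: mul1r.
Qed.

(* A nonnegative function killed by the character [ch] vanishes at [w]: adding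
   |zeta - w|^2 would otherwise make it invertible. *)
Lemma corner_char_pos (f : Ccircle C) : (forall z, 0 <=
  (f z : C)) -> ch f = 0 -> f w = 0.
Proof.
move=> f0 chf; apply: contrapT => fw.
pose q := zeta R - (cval w) *: oneT R.
pose k := 1 *: f + astar q ** q.
have qE z : q z = cval z - cval w :> C by rewrite -[cval w in RHS]mulr1.
have chq : ch q = 0.
  have -> : q = (- cval w) *: oneT R + zeta R by rewrite /q scaleNr addrC.
  by rewrite corner_char_linear corner_char1 corner_char_zeta mulr1 addNr.
have kE z : k z = (f z : C) + `|cval z - cval w| ^+ 2.
  by rewrite -qE normCKC -[f z in RHS]mul1r.
have k0 z : k z != 0.
  rewrite kE paddr_eq0 ?f0 ?exprn_ge0 //; apply/negP => /andP[/eqP fz].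
  rewrite expf_eq0 /= normr_eq0 subr_eq0 => /eqP /cval_inj zw.
  by apply: fw; rewrite -zw.
have : ch (k ** invT k0) = 0.
  by rewrite corner_charM corner_char_linear corner_charM chf chq mulr0 mulr0
    addr0 mul0r.
have -> : k ** invT k0 = oneT R by apply/continuousEP => z; exact: mulfV.
by rewrite corner_char1 => /eqP; rewrite oner_eq0.
Qed.

(** Otherwise pick [s] strictly between [|h f|^2] and [|f w|^2], and put [c = |f|^2],
    [g = max(c - s, 0)], [mx = max(c, s)]. Since [c = mx] wherever [g] is nonzero, [g = (c / mx) g],
    while [h (c / mx)] has norm at most [|h f|^2 / s < 1]. Hence [h g = 0], so the character kills
    [g] and [g w = 0], which contradicts [c w > s]. *)
Lemma corner_calc_ge (f : Ccircle C) : `|f w : C| <= `|h f|.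
Proof.
have [//|] := real_leP (normr_real (f w : C)) (normr_real (h f)) => lt_hf.
set n := `|h f| in lt_hf; set m := `|f w : C| in lt_hf.
have n0 : 0 <= n by exact: normr_ge0.
have nm : n ^+ 2 < m ^+ 2 by rewrite ltr_pXn2r ?nnegrE //; exact: normr_ge0.
pose s := (n ^+ 2 + m ^+ 2) / 2.
have ns : n ^+ 2 < s by rewrite ltr_pdivlMr // mulr_natr mulr2n ltrD2l.
have sm : s < m ^+ 2 by rewrite ltr_pdivrMr // mulr_natr mulr2n ltrD2r.
have s0 : 0 < s by rewrite (le_lt_trans _ ns) // exprn_ge0.
pose c := astar f ** f.
have cE z : c z = `|f z : C| ^+ 2 by rewrite normCKC.
have cR z : (c z : C) \is Num.real by rewrite cE rpredX // normr_real.
pose ab := absT (c - s *: oneT R).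
have abE z : ab z = `|(c z : C) - s| by rewrite -[s in RHS]mulr1.
pose g := 2^-1 *: (c - s *: oneT R + ab).
pose mx := 2^-1 *: (c + s *: oneT R + ab).
have gE z : g z = ((c z : C) - s + `|(c z : C) - s|) / 2.
  by rewrite -abE mulrC -[s in RHS]mulr1.
have mE z : mx z = ((c z : C) + s + `|(c z : C) - s|) / 2.
  by rewrite -abE mulrC -[s in RHS]mulr1.
have caseE z : (g z = 0 /\ mx z = s) \/
    (s <= (c z : C) /\ g z = (c z : C) - s /\ mx z = (c z : C)).
  rewrite gE mE; have [sc|cs] := real_leP (gtr0_real s0) (cR z).
    by right; split=> //; split; field.
  by left; split; field.
have ms z : s <= mx z :> C by case: (caseE z) => [[_ ->]|[? [_ ->]]].
have m0 z : mx z != 0 by rewrite gt_eqF // (lt_le_trans s0).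
have gfac : g = c ** invT m0 ** g.
  apply/continuousEP => z; rewrite -[RHS]/((c z : C) / mx z * g z).
  case: (caseE z) => [[-> _]|[cs [_ ->]]]; first by rewrite mulr0.
  by rewrite mulfV ?mul1r // gt_eqF // (lt_le_trans s0).
have hc : `|h c| = n ^+ 2 by rewrite corner_calcM corner_calc_star norm_cstar.
have hi : `|h (invT m0)| <= s^-1.
  apply: norm_corner_calc => [|z]; first by rewrite invr_ge0 ltW.
  rewrite -[invT m0 z]/((mx z : C)^-1) normfV lef_pV2 ?posrE ?normr_gt0 //.
  by rewrite ger0_norm // ltW // (lt_le_trans s0).
have hg : h g = 0.
  apply/eqP; rewrite -normr_eq0; apply/eqP; apply: contrapT => /eqP hg0.
  have hg_gt : 0 < `|h g| by rewrite lt_neqAle eq_sym hg0 normr_ge0.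
  have : `|h g| <= n ^+ 2 * s^-1 * `|h g|.
    rewrite {1}gfac (corner_calcM (c ** invT m0)) (corner_calcM c);
      apply: le_trans (norm_amul _ _) _.
    apply: ler_wpM2r => //; apply: le_trans (norm_amul _ _) _.
    by rewrite hc; apply: ler_wpM2l; rewrite ?exprn_ge0.
  rewrite -[X in X <= _]mul1r (ler_pM2r hg_gt) ler_pdivlMr // mul1r => sn.
  by have := lt_le_trans ns sn; rewrite ltxx.
have gw : g w = 0.
  apply: corner_char_pos => [z|]; last first.
    by rewrite /ch hg (lin0 (star_hom_linear sigma_hom)) ffunE.
  case: (caseE z) => [[-> _]|[cs [-> _]]]; first exact: lexx.
  by rewrite subr_ge0.
have := gw; case: (caseE w) => [[_ mw]|[_ [-> _]]].
  move: mw; rewrite mE cE -/m ger0_norm ?subr_ge0 ?(ltW sm) // => mw _.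
  have ms2 : m ^+ 2 = s by rewrite -mw; field.
  by move: sm; rewrite ms2 ltxx.
by move=> /eqP; rewrite subr_eq0 cE -/m => /eqP ms2; move: sm; rewrite ms2 ltxx.
Qed.

End Corner.

End Universal.

End CentralGenerator.

(** * Identification of the Cuntz-Pimsner algebra *)

Lemma star_hom_inverse (C : numClosedFieldType) (A D : starAlgType C)
  (f : A -> D) : star_hom f -> injective f -> (forall y, exists x, f x = y) ->
  star_isomorphic D A.
Proof.
move=> f_hom f_inj f_surj; pose g y := projT1 (cid (f_surj y)).
have gK : cancel g f by move=> y; exact: projT2 (cid (f_surj y)).
exists g; last by exists f => // x; exact: f_inj.
split=> [k x y|x y|x]; apply: f_inj.
- by rewrite (star_hom_linear f_hom) !gK.
- by rewrite (star_homM f_hom) !gK.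
- by rewrite (star_hom_star f_hom) !gK.
Qed.

Lemma closed_norm (R : realType) (V : normedModType R[i]) (S : set V) (a : V) :
  closed S -> (forall e : R[i], 0 < e -> exists2 b, S b & `|a - b| <= e) -> S a.
Proof.
move=> Sc aS; apply: Sc => A /nbhs_ballP[e e0 eA].
have [b Sb ab] := aS _ (divr_gt0 e0 (ltr0Sn _ 1)).
exists b; split=> //; apply: eA; rewrite -ball_normE /=.
by rewrite (le_lt_trans ab) // gtr_pMr // invf_lt1 // ltr1n.
Qed.

Section Generation.
Context (R : realType) (d : nat) (N : 'I_d -> nat).
Local Notation C := R[i].
Local Notation B := (tens N C^o).
Local Notation M := (tens N (Ccircle C)).
Context (X : corr C N) (u : X).
Hypothesis u_unit : cinner u u = unitB.
Hypothesis u_central : forall b xi, cinner u (lact b xi) = b ** cinner u xi.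
Hypothesis u_inner : forall xi eta,
  cinner xi eta = astar (cinner u xi) ** cinner u eta.

(** The element [1 (x) z] is [model_t u u], so all [b (x) p] with [p] a Laurent polynomial are
    generated; approximating the finitely many entries of [x] separately gives the rest. *)
Lemma model_generates : generates (@model_pi R d N) (model_t u).
Proof.
move=> S Sc S0 Slin Smul Sstar Spi St x.
have Ssum (I : eqType) (r : seq I) (F : I -> M) :
    (forall i, S (F i)) -> S (\sum_(i <- r) F i).
  move=> SF; elim: r => [|i r IH]; first by rewrite big_nil.
  by rewrite big_cons -[F i]scale1r; exact: Slin.
have Sz (a : M) (k : C) : S a -> S (k *: a).
  by move=> Sa; rewrite -[_ *: _]addr0; exact: Slin.
have Spow j : S (vpow (model_pi unitB) (model_t u u) j).
  by case: j => n /=; [|apply: (Smul); first exact: Sstar (St u)];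
    elim: n => //= n IH; apply: Smul => //; exact: Sstar.
have Slaurent b s : S (etens b (leval (oneT R) (zeta R) s)).
  have -> : etens b (leval (oneT R) (zeta R) s) =
      model_pi b ** etens unitB (leval (oneT R) (zeta R) s).
    by rewrite /model_pi etens_mul amulB1 mul1T.
  apply: Smul => //.
  rewrite (star_hom_leval _ _ s (etens_unit_hom N (Ccircle C))).
  have -> : etens unitB (zeta R) = model_t u u :> M by rewrite /model_t u_unit.
  by rewrite /leval; apply: Ssum => p; apply: Sz; exact: Spow.
apply: closed_norm Sc _ => e e0.
have t1 : 0 < tdim R N + 1 by rewrite ltr_wpDl ?ler0n.
have [s sP] := choice (fun i => laurent_dense (x i) (divr_gt0 e0 t1)).
exists (\sum_i etens (munit C i) (leval (oneT R) (zeta R) (s i))).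
  by apply: (Ssum _ (index_enum _)) => i.
apply: (@le_trans _ _ (tdim R N * (e / (tdim R N + 1)))).
  apply: tnorm_crude => [|i z]; first by rewrite divr_ge0 // ltW.
  rewrite tens_sum_etens !ffunE.
  have := sP i z; rewrite -leval_zeta; exact.
by rewrite mulrC -mulrA ger_pMr // ler_pdivrMl // mulr1 lerDl.
Qed.

Lemma model_cuntz_pimsner : cuntz_pimsner X M.
Proof.
exists (@model_pi R d N), (model_t u); split; first exact: model_generates.
split; first exact: model_covariant.
move=> D pi t cov; exists (model_lift u_unit u_central u_inner cov); split.
- exact: model_lift_hom.
- exact: model_lift_pi.
- exact: model_lift_t.
Qed.

Lemma cuntz_pimsner_isomorphic (O : cstarAlgType C) :
  cuntz_pimsner X O -> star_isomorphic O M.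
Proof.
move=> [pi [t [gen [cov univ]]]].
have [sigma [sigma_hom sigma_pi sigma_t]] :=
  univ _ _ _ (model_covariant u_unit u_central u_inner).
have [tau [tau_hom tau_pi tau_t [K K0 upper] corner_ge]] : exists tau : M -> O,
    [/\ star_hom tau, forall b, tau (etens b (oneT R)) = pi b,
      forall xi, tau (model_t u xi) = t xi,
      exists2 K : C, 0 <= K & forall x, `|tau x| <= K * `|x| &
      forall a (p : 'I_(N a)) (f : Ccircle C) z, `|f z : C| <=
        `|tau (etens (munit C (mi p p)) f)|].
  exists (model_lift u_unit u_central u_inner cov); split.
  - exact: model_lift_hom.
  - exact: model_lift_pi.
  - exact: model_lift_t.
  - exact: model_lift_bounded.
  - move=> a p f z; rewrite model_lift_etens.
    exact: (corner_calc_ge u_unit u_central u_inner cov sigma_hom sigma_pi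
      sigma_t).
have tau_lin := star_hom_linear tau_hom.
have tau_mul (x y : M) : tau (x ** y) = tau x ** tau y by exact: star_homM.
have tauB x y : tau (x - y) = tau x - tau y.
  by rewrite -scaleN1r (star_homD tau_hom) (star_homZ tau_hom) scaleN1r.
have entry (x : M) i z : `|x i z : C| <= `|tau x|.
  (* Multiplying [tau x] by images of matrix units, which have norm at most 1, isolates the entry
     [(p, q)] in the corner of [e_pp]. *)
  case: i => a [p q]; apply: le_trans (corner_ge a p (x (mi p q)) z) _.
  have -> : tau (etens (munit C (mi p p)) (x (mi p q))) =
      pi (munit C (mi p p)) ** tau x ** pi (munit C (mi q p)).
    apply: etrans (congr1 tau (esym (etens_compress p q p x (@mul1T R) (@mulT1
      R)))) _.
    apply: etrans (tau_mul _ _) _; apply: (congr2 amul); last exact: tau_pi.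
    by apply: etrans (tau_mul _ _) _; apply: (congr2 amul); first exact: tau_pi.
  apply: le_trans (norm_amul _ _) _; rewrite -[leRHS]mulr1.
  apply: ler_pM => //; last by apply: (norm_pi_munit cov).
  apply: le_trans (norm_amul _ _) _; rewrite -[leRHS]mul1r.
  by apply: ler_pM => //; apply: (norm_pi_munit cov).
have lower x : `|x| <= tdim R N * `|tau x|.
  by apply: tnorm_crude => // i z; exact: entry.
apply: (star_hom_inverse tau_hom) => [x y xy|y].
  apply/eqP; rewrite -subr_eq0 -normr_le0 (le_trans (lower _)) //.
  by rewrite tauB xy subrr normr0 mulr0.
apply: (gen [set y | exists x, tau x = y]) =>
  [|||a b [x <-] [x' <-]|a [x <-]|b|xi] /=.
(* Closed range: for a sequence whose images approximate [a], the lower bound makes the sequence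
   itself Cauchy, and the upper bound shows that its limit is mapped to [a]. *)
- move=> a aS.
  have [x xP] : exists x : nat -> M, forall n, `|a - tau (x n)| <= harm R n.
    suff /choice[x xP] : forall n, exists x, `|a - tau x| <=
      harm R n by exists x.
    move=> n; have [_ [[x <-] ax]] := aS _ (nbhsx_ballx a _ (harm_gt0 R n)).
    by exists x; move: ax; rewrite -ball_normE => /ltW.
  have t0 : 0 <= tdim R N by rewrite ler0n.
  have [|l lP] := @harm_limit R M x (tdim R N) t0.
    move=> m n; apply: le_trans (lower _) _; apply: ler_wpM2l => //.
    rewrite tauB -(subrKA a) (le_trans (ler_normD _ _)) // lerD // distrC.
    exact: xP.
  exists l; apply/eqP; rewrite -subr_eq0 -normr_le0; apply/ler_addgt0Pr => e e0.
  have c0 : 0 < K * tdim R N + 1 by rewrite ltr_wpDl // mulr_ge0.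
  have [n hn] := harm_small (divr_gt0 e0 c0).
  have {hn} := hn n (leqnn n); rewrite add0r ler_pdivlMr // mulrDr mulr1 => hn.
  rewrite -(subrKA (tau (x n))) (le_trans (ler_normD _ _)) //
    (le_trans _ hn) //.
  rewrite lerD //; last by rewrite distrC xP.
  rewrite -tauB; apply: le_trans (upper _) _.
  rewrite mulrCA; apply: ler_wpM2l => //; rewrite mulrC; exact: lP.
- by exists 0; exact: lin0 tau_lin.
- by move=> k a b [x <-] [x' <-]; exists (k *: x + x'); exact: tau_lin.
- by exists (x ** x'); exact: star_homM.
- by exists (astar x); exact: star_hom_star.
- by exists (model_pi b); exact: tau_pi.
- by exists (model_t u xi); exact: tau_t.
Qed.

End Generation.

Theorem proposition4p10 (R : realType) (d : nat) (N : 'I_d -> nat)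
    (N_gt0 : forall a, (0 < N a)%N)
    (G : qgraph R[i] N) (T : fdalg N R[i])
    (T_rank_one : rank_one G T)
    (T_neq0 : forall a, block a T != 0) :
  (exists O : cstarAlgType R[i], cuntz_pimsner (edge_corr G) O) /\
  (forall O : cstarAlgType R[i], cuntz_pimsner (edge_corr G) O ->
     star_isomorphic O (tens N (Ccircle R[i]))).
Proof.
have [u [u_unit u_central u_inner]] := edge_central_unit T_rank_one T_neq0.
split; last exact: cuntz_pimsner_isomorphic u_unit u_central u_inner.
exists (tens N (Ccircle R[i])).
exact: model_cuntz_pimsner u_unit u_central u_inner.
Qed.
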